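(* Let $K,L\subset\mathbb{R}^n$ be convex bodies and let $\lambda\in(0,1)$. Then $$\mathcal{W}\bigl((1-\lambda)K+\lambda L\bigr)\geq\mathcal{W}(K)^{1-\lambda}\,\mathcal{W}(L)^{\lambda},$$ where $\mathcal{W}$ is the Wills functional.
   Context: A convex body in $\mathbb{R}^n$ is a non-empty compact convex set; $+$ between sets is Minkowski addition; $\mathrm{vol}$ is $n$-dimensional Lebesgue measure. With $B_2^n$ the Euclidean unit ball and $\kappa_j=\mathrm{vol}_j(B_2^j)=\pi^{j/2}/\Gamma(j/2+1)$, the intrinsic volumes $\mathrm{V}_i(K)$, $0\le i\le n$, of a convex body $K$ are defined by the Steiner formula $\mathrm{vol}(K+\lambda B_2^n)=\sum_{i=0}^n\kappa_{n-i}\mathrm{V}_i(K)\lambda^{n-i}$ for all $\lambda\geq 0$. The Wills functional is $\mathcal{W}(K)=\sum_{i=0}^n\mathrm{V}_i(K)$; equivalently, $\mathcal{W}(K)=\int_{\mathbb{R}^n}e^{-\pi d(x,K)^2}\,dx$, where $d(x,K)$ is the Euclidean distance from $x$ to $K$. *)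

(* Defs.v *)
From HB Require Import structures.
From mathcomp Require Import all_boot all_order all_algebra.
From mathcomp Require Import all_classical all_reals all_analysis.

Set Implicit Arguments.
Unset Strict Implicit.
Unset Printing Implicit Defensive.

Import Order.TTheory GRing.Theory Num.Theory.
Import numFieldNormedType.Exports.

Local Open Scope classical_set_scope.
Local Open Scope ring_scope.

(* Lebesgue measure on R^n is the n-fold product of the one-dimensional
   Lebesgue measure, on the product sigma-algebra of n-tuples.  The library
   only has binary products, so it is built by recursion on n, transporting
   the product of R and R^n to R^(n+1) along [consp]. *)
Section LebesgueTuple.
Context (R : realType).
Local Notation mR := (measurableTypeR R).

Definition consp n (x : mR * n.-tuple mR) : n.+1.-tuple mR :=
  [tuple of x.1 :: x.2].

Lemma measurable_consp n : measurable_fun [set: mR * n.-tuple mR] (@consp n).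
Proof. exact: measurable_cons. Qed.

Section Step.
Context n (mu : {sigma_finite_measure set (n.-tuple mR) -> \bar R}).

Let lebesgue : {sigma_finite_measure set mR -> \bar R} := @lebesgue_measure R.

Definition lebesgue_cons : set (n.+1.-tuple mR) -> \bar R :=
  pushforward (lebesgue \x mu)%E (@consp n).

Let mcons A : measurable A -> measurable (@consp n @^-1` A).
Proof. by move=> mA; rewrite -[X in measurable X]setTI; exact: measurable_consp. Qed.

Let lebesgue_cons0 : lebesgue_cons set0 = 0%E.
Proof. by rewrite /lebesgue_cons /pushforward preimage_set0 measure0. Qed.

Let lebesgue_cons_ge0 A : (0 <= lebesgue_cons A)%E.
Proof. by rewrite /lebesgue_cons /pushforward; apply: integral_ge0 => x _ /=. Qed.

Let lebesgue_cons_sigma_additive : semi_sigma_additive lebesgue_cons.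
Proof.
move=> F mF tF mUF; rewrite /lebesgue_cons /pushforward preimage_bigcup.
apply: measure_semi_sigma_additive.
- by move=> i; exact: mcons.
- apply/trivIsetP => /= i j _ _ ij; rewrite -preimage_setI.
  by move/trivIsetP : tF => /(_ _ _ _ _ ij) ->//; rewrite preimage_set0.
- by rewrite -preimage_bigcup; exact: mcons.
Qed.

HB.instance Definition _ := isMeasure.Build _ _ _ lebesgue_cons
  lebesgue_cons0 lebesgue_cons_ge0 lebesgue_cons_sigma_additive.

Let lebesgue_cons_sigma_finite : sigma_finite setT lebesgue_cons.
Proof.
have /sigma_finiteP[F [FT Fnd Foo]] := sigma_finiteT lebesgue.
have /sigma_finiteP[G [GT Gnd Goo]] := sigma_finiteT mu.
exists (fun k => (fun t : n.+1.-tuple mR => thead t) @^-1` F k `&`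
                 (fun t : n.+1.-tuple mR => [tuple of behead t]) @^-1` G k).
  apply/esym; rewrite -subTset => t _.
  have [i _ Fi] : (\bigcup_i F i) (thead t) by rewrite -FT.
  have [j _ Gj] : (\bigcup_i G i) [tuple of behead t] by rewrite -GT.
  exists (maxn i j) => //; split => /=.
    exact: (subsetPset _ _ (Fnd _ _ (leq_maxl i j))).
  exact: (subsetPset _ _ (Gnd _ _ (leq_maxr i j))).
move=> k; have [mF Fk] := Foo k; have [mG Gk] := Goo k; split.
  apply: measurableI; rewrite -[X in measurable X]setTI.
    exact: (@measurable_tnth _ mR n.+1 ord0 measurableT (F k)).
  exact: (@measurable_behead _ mR n measurableT (G k)).
rewrite /lebesgue_cons /pushforward (_ : _ @^-1` _ = F k `*` G k); last first.
  have tbE x (y : n.-tuple mR) : [tuple of behead (consp (x, y))] = y.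
    exact/val_inj.
  by apply/seteqP; split => -[x y] /=; rewrite theadE tbE.
by rewrite product_measure1E// lte_mul_pinfty// ge0_fin_numE.
Qed.

HB.instance Definition _ := Measure_isSigmaFinite.Build _ _ _ lebesgue_cons
  lebesgue_cons_sigma_finite.

Definition lebesgue_tuple_step :
  {sigma_finite_measure set (n.+1.-tuple mR) -> \bar R} := lebesgue_cons.

End Step.

Fixpoint lebesgue_tuple n :
    {sigma_finite_measure set (n.-tuple mR) -> \bar R} :=
  if n is m.+1 then lebesgue_tuple_step (lebesgue_tuple m)
  else \d_([tuple] : 0.-tuple mR).

End LebesgueTuple.

Section Wills.
Context (R : realType).

Definition vol n (A : set 'rV[R]_n) : \bar R :=
  lebesgue_tuple R n [set t | A (\row_i tnth t i)].

Definition convex_body n (K : set 'rV[R]_n) : Prop :=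
  [/\ K !=set0, compact K & convex_set (K : set (convex_lmodType 'rV[R]_n))].

Definition minkowski_sum n (A B : set 'rV[R]_n) : set 'rV[R]_n :=
  [set x + y | x in A & y in B].

Definition dilate n (c : R) (A : set 'rV[R]_n) : set 'rV[R]_n :=
  [set c *: x | x in A].

(* The library norm on 'rV[R]_n is the sup norm, hence the explicit sum. *)
Definition euclidean_ball n : set 'rV[R]_n :=
  [set x | \sum_(i < n) x ord0 i ^+ 2 <= 1].

Definition kappa (j : nat) : R := fine (vol (@euclidean_ball j)).

Definition steiner_formula n (K : set 'rV[R]_n) (V : {ffun 'I_n.+1 -> R}) :
    Prop :=
  forall lambda : R, 0 <= lambda ->
    vol (minkowski_sum K (dilate lambda (@euclidean_ball n))) =
    (\sum_(i < n.+1) kappa (n - i) * V i * lambda ^+ (n - i))%:E.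

(* For a convex body K there is exactly one family satisfying the Steiner
   formula; [xget] selects it.  The default value 0 is only used for sets K
   that admit no such family. *)
Definition intrinsic_volume n (K : set 'rV[R]_n) : {ffun 'I_n.+1 -> R} :=
  xget 0 [set V | steiner_formula K V].

Definition wills n (K : set 'rV[R]_n) : R :=
  \sum_(i < n.+1) intrinsic_volume K i.

End Wills.

(* Main.v *)
(* The Wills functional is the integral of exp (- pi d(x, K)^2), and this
   Gaussian of the distance is log-concave jointly in x and K because the squared
   distance is jointly convex; the inequality is therefore an instance of the
   Prekopa-Leindler inequality, which is proved by induction on the dimension
   from its one-dimensional case.

   Passing from intrinsic volumes to the integral requires the Steiner formula.
   For a segment S the volume of K + t S is affine in t, so vol (K + t Z) is
   polynomial in t for every zonotope Z, of degree at most n by homogeneity.  The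
   Euclidean ball is a limit of zonotopes: the mean of |<u, X>| for a standard
   Gaussian vector X is proportional to |u|, and discretizing X turns it into
   the support function of a zonotope.  Limits of polynomials of bounded degree
   are polynomials.

   In the integral representation the constants need no Gamma function: the
   layer cake formula for K expresses the integral through the moments of the
   level radius, and the same formula for K = {0} in dimension j, where the
   integral is 1, identifies the j-th moment as 1 / kappa_j. *)
Require Import Defs.
From HB Require Import structures.
From mathcomp Require Import all_boot all_order all_algebra.
From mathcomp Require Import all_classical all_reals all_analysis.
From mathcomp Require Import measurable_realfun.
From mathcomp Require Import zify ring lra.

Set Implicit Arguments.
Unset Strict Implicit.
Unset Printing Implicit Defensive.

Import Order.TTheory GRing.Theory Num.Theory.
Import numFieldNormedType.Exports.

Local Open Scope classical_set_scope.
Local Open Scope ring_scope.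

(** * The Prekopa-Leindler inequality *)

(** On the line the inequality is first proved in additive form: once both functions are scaled to
    supremum 1, their superlevel sets at every height below 1 are nonempty, one-dimensional
    Brunn-Minkowski applies height by height, and weighted AM-GM returns the product. The combined
    set or function is always an arbitrary measurable majorant, which sidesteps the measurability of
    Minkowski sums. Adding a segment is reduced by a shear to fibres parallel to the first axis. The
    directions must therefore have a nonzero first coordinate, and the discretized Gaussian is
    arranged to have no zero coordinate. Instead of rotation invariance of the Gaussian vector, a
    convolution identity on the line is applied once per coordinate. The ball is approximated
    multiplicatively: for a > 1 some zonotope lies between a^-1 B and a B. When K contains 0 this
    becomes a relative error of the volumes that is uniform in t, and interpolation at finitely many
    integers carries polynomiality to the limit. *)

Section RealLine.
Context (R : realType).
Local Notation mR := (measurableTypeR R).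
Local Notation leb := (@lebesgue_measure R : set mR -> \bar R).
Implicit Types (a b : R) (A : set mR).

Lemma measurable_affine a b :
  measurable_fun [set: mR] (fun x : mR => (a * x + b : mR)).
Proof. by apply: measurable_funD => //; exact: measurable_funM. Qed.

(** The left side is a measure in [A], so by uniqueness of Lebesgue measure it suffices to compare
    half-open intervals. *)
Lemma lebesgue_measure_affine_gt0 a b A : 0 < a -> measurable A ->
  (a%:E * leb ((fun x => a * x + b)%R @^-1` A))%E = leb A.
Proof.
move=> a0 mA.
pose f : {mfun mR >-> mR} :=
  HB.pack (fun x : mR => (a * x + b : mR))
    (isMeasurableFun.Build _ _ _ _ _ (measurable_affine a b)).
apply/esym.
apply: (@lebesgue_measure_unique _ (mscale (NngNum (ltW a0)) (pushforward leb f))) => //=.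
move=> _ [[c d]] _ <-.
rewrite /mscale/= /pushforward.
have -> : f @^-1` `]c, d] = `](c - b) / a, (d - b) / a]%classic.
  apply/seteqP; split => x /=; rewrite !in_itv/= ltr_pdivrMr// ler_pdivlMr//;
   by rewrite ltrBlDr lerBrDr (mulrC a).
rewrite !lebesgue_measure_itv/= !lte_fin ltr_pM2r ?invr_gt0// ltrD2r.
case: ifP => _; rewrite ?mule0// -!EFinD -EFinM; congr EFin.
by field; rewrite gt_eqF.
Qed.

Lemma lebesgue_measure_affine a b A : a != 0 -> measurable A ->
  (`|a|%:E * leb ((fun x => a * x + b)%R @^-1` A))%E = leb A.
Proof.
move=> a_neq0 mA; have [a0|a0] := ltP 0 a.
  by rewrite gtr0_norm// lebesgue_measure_affine_gt0.
have {a_neq0}a0 : a < 0 by rewrite lt_neqAle a_neq0.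
rewrite ltr0_norm//.
have mNA : measurable ((fun x : mR => (- x : mR)) @^-1` A).
  rewrite -[X in measurable X]setTI.
  have -> : (fun x : mR => (- x : mR)) = (fun x : mR => (-1 * x + 0 : mR)).
    by apply/funext => x; rewrite mulN1r addr0.
  exact: measurable_affine.
rewrite -[RHS]lebesgue_measureN// /pushforward.
rewrite -(@lebesgue_measure_affine_gt0 (- a) (- b) _ _ mNA) ?oppr_gt0//.
by congr (_ * leb _)%E; apply/seteqP; split => x /=; rewrite mulNr -opprD opprK.
Qed.

Lemma integral_affine a b (f : mR -> \bar R) : a != 0 ->
  measurable_fun setT f -> (forall x, 0 <= f x)%E ->
  (`|a|%:E * \int[leb]_x f (a * x + b)%R = \int[leb]_x f x)%E.
Proof.
move=> a0 mf f0.
have mg := measurable_affine a b.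
have -> : (\int[leb]_x f (a * x + b)%R =
  \int[pushforward leb (fun x : mR => (a * x + b : mR)%R)]_x f x)%E.
  by rewrite ge0_integral_pushforward//= ?preimage_setT.
pose ph : {measure set mR -> \bar R} :=
  measure_function_pushforward__canonical__measure_function_Measure leb mg.
rewrite -[X in (_ * X)%E]/(\int[ph]_x f x)%E.
rewrite -(@ge0_integral_mscale _ mR R ph setT measurableT (NngNum (normr_ge0 a)) f)//.
apply: eq_measure_integral => //= A mA _.
by rewrite /mscale/= /pushforward; exact: lebesgue_measure_affine.
Qed.

End RealLine.

(** * Suprema and weighted AM-GM in the extended reals *)

Section EReal.
Context (R : realType).
Implicit Types (p q : R) (z : \bar R) (S : set (\bar R)).
Local Open Scope ereal_scope.

(** Passes to a supremum in one summand at a time; [c] may be [+oo] because measures may be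
    infinite. *)
Lemma ereal_sup_mull_le p S c z : (0 < p)%R -> c != -oo ->
  (S !=set0) -> (forall x, S x -> 0 <= x) -> (forall x, S x -> p%:E * x + c <= z) ->
  p%:E * ereal_sup S + c <= z.
Proof.
move=> p0 cNy S0 S_ge0 H.
case: c cNy H => // [c|] _ H; last first.
  have [x Sx] := S0; have := H _ Sx.
  rewrite addey ?leye_eq => [/eqP ->|]; first by rewrite leey.
  by rewrite gt_eqF// (lt_le_trans ltNy0)// mule_ge0 ?lee_fin ?(ltW p0)//; exact: S_ge0.
rewrite -leeBrDr// -lee_pdivlMl//; apply: ge_ereal_sup => x Sx.
by rewrite lee_pdivlMl// leeBrDr//; exact: H.
Qed.

(** Multiplicative counterpart, for one factor at a time. If [c] is [+oo], either some element of
    [S] is nonzero and [z] is [+oo], or the supremum is 0 and the product vanishes by the convention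
    [0 * +oo = 0]. *)
Lemma poweR_sup_mulr_le p S c z : (0 < p)%R -> 0 <= c -> 0 <= z ->
  (forall x, S x -> 0 <= x) -> (forall x, S x -> x `^ p * c <= z) ->
  S !=set0 -> ereal_sup S `^ p * c <= z.
Proof.
move=> p0 c0 z0 S_ge0 H [x0 Sx0].
have s0 : 0 <= ereal_sup S.
  by apply: le_trans (ereal_sup_ubound Sx0); exact: S_ge0.
case: c c0 H => // [c|_ H]; last first.
  have [[x Sx x0_]|nx] := pselect (exists2 x, S x & x != 0).
    have := H _ Sx; rewrite gt0_muley ?leye_eq => [/eqP ->|]; first by rewrite leey.
    by rewrite poweR_gt0// lt0e x0_ S_ge0.
  suff -> : ereal_sup S = 0 by rewrite poweR0r ?gt_eqF// mul0e.
  apply/eqP; rewrite eq_le s0 andbT; apply: ge_ereal_sup => x Sx.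
  by apply: contrapT => x_; apply: nx; exists x => //; apply/eqP => xE; rewrite xE lexx in x_.
rewrite lee_fin le_eqVlt => /predU1P[<- _|c0 H]; first by rewrite mule0.
rewrite -lee_pdivlMr// -[leRHS](@poweRe1 _ _ _); last first.
  by rewrite mule_ge0// lee_fin invr_ge0 ltW.
rewrite -(mulVf (lt0r_neq0 p0)) poweRrM; apply: gt0_ler_poweR; first exact: ltW.
- by rewrite in_itv/= s0 leey.
- by rewrite in_itv/= poweR_ge0 leey.
apply: ge_ereal_sup => x Sx.
have -> : x = (x `^ p) `^ (p^-1).
  by rewrite -poweRrM mulfV ?gt_eqF// poweRe1// S_ge0.
apply: gt0_ler_poweR; first by rewrite invr_ge0 ltW.
- by rewrite in_itv/= poweR_ge0 leey.
- by rewrite in_itv/= leey mule_ge0// lee_fin invr_ge0 ltW.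
by rewrite lee_pdivlMr//; exact: H.
Qed.

Lemma weighted_AGM p x y : (0 < p < 1)%R -> 0 <= x -> 0 <= y ->
  x `^ (1 - p) * y `^ p <= (1 - p)%:E * x + p%:E * y.
Proof.
move=> /andP[p0 p1]; have q0 : (0 < 1 - p)%R by rewrite subr_gt0.
case: x => [x|_|//]; case: y => [y|_|//]; rewrite ?lee_fin.
- move=> x0 y0.
  (* Young's inequality for the conjugate exponents 1 / (1 - p) and 1 / p. *)
  have := @conjugate_powR R (x `^ (1 - p))%R (y `^ p)%R (1 - p)^-1%R p^-1%R
    (powR_ge0 _ _) (powR_ge0 _ _).
  rewrite !invr_gt0 !invrK subrK -!powRrM !divff ?gt_eqF// !powRr1//.
  by rewrite (mulrC x) (mulrC y); apply.
- move=> _; have -> : p%:E * +oo = +oo by rewrite gt0_muley ?lte_fin.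
  by rewrite -EFinM addey ?leey.
- move=> y0; have -> : (1 - p)%:E * +oo = +oo by rewrite gt0_muley ?lte_fin.
  by rewrite -EFinM addye ?leey.
- by rewrite !gt0_muley ?lte_fin ?leey.
Qed.

End EReal.

(** * The layer cake formula with strict superlevel sets *)

Section LayerCake.
Context d (T : measurableType d) (R : realType).
Variable mu : {sigma_finite_measure set T -> \bar R}.
Local Notation mR := (measurableTypeR R).
Let leb : {sigma_finite_measure set mR -> \bar R} := @lebesgue_measure R.
Local Open Scope ereal_scope.

Lemma measurable_superlevel_pair (F : T -> \bar R) : measurable_fun setT F ->
  measurable [set z : mR * T | z.1%:E < F z.2].
Proof.
move=> mF; rewrite -[X in measurable X]setTI; apply: measurable_lte => //.
  by apply/measurable_EFinP; exact: measurable_fst.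
by apply: measurableT_comp.
Qed.

Lemma measurable_superlevel (F : T -> \bar R) : measurable_fun setT F ->
  measurable_fun setT (fun t : mR => mu [set x | t%:E < F x]).
Proof.
move=> /measurable_superlevel_pair mD.
rewrite (_ : (fun t => _) = mu \o xsection [set z : mR * T | z.1%:E < F z.2]).
  exact: measurable_fun_xsection.
apply/funext => t /=; congr (mu _).
by apply/seteqP; split => x; rewrite /xsection/= inE.
Qed.

(** Tonelli on the region [D] under the graph: its vertical fibres have length [F x], its horizontal
    fibres are the superlevel sets. *)
Lemma layer_cake (F : T -> \bar R) : measurable_fun setT F ->
  (forall x, 0 <= F x) ->
  \int[mu]_x F x = \int[leb]_(t in `[0%R, +oo[) mu [set x | t%:E < F x].
Proof.
move=> mF F0; set D := [set z : mR * T | (0 <= z.1)%R /\ z.1%:E < F z.2].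
have mD : measurable D.
  rewrite (_ : D = fst @^-1` `[0%R, +oo[ `&` [set z | z.1%:E < F z.2]).
    apply: measurableI; last exact: measurable_superlevel_pair.
    by rewrite -[X in measurable X]setTI; exact: measurable_fst.
  by apply/seteqP; split => z; rewrite /D/= in_itv/= andbT.
transitivity (\int[mu]_x \int[leb]_t (\1_D (t, x))%:E).
  apply: eq_integral => x _.
  have -> : (fun t : mR => (\1_D (t, x))%:E) =
            (fun t : mR => (\1_(ysection D x) t)%:E :> \bar R).
    by apply/funext => t; rewrite !indicE /ysection mem_setE.
  rewrite integral_indic//=; last exact: measurable_ysection.
  rewrite setIT.
  have -> : ysection D x = [set t | (0 <= t)%R /\ t%:E < F x].
    by apply/seteqP; split => t; rewrite /ysection/= inE.
  have := F0 x; case: (F x) => [r|_|//].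
    rewrite lee_fin => r0.
    have -> : [set t | (0 <= t)%R /\ t%:E < r%:E] = `[0%R, r[%classic.
      by apply/seteqP; split => t /=; rewrite in_itv/= lte_fin => /andP.
    rewrite lebesgue_measure_itv/= lte_fin; case: ltP => [_|]; first by rewrite oppr0 adde0.
    by move=> r0'; congr EFin; apply/eqP; rewrite eq_le r0 r0'.
  have -> : [set t : R | (0 <= t)%R /\ t%:E < +oo] = `[0%R, +oo[%classic.
    apply/seteqP; split => t /=; rewrite in_itv/= andbT; first by case.
    by move=> ->; rewrite ltry.
  by rewrite lebesgue_measure_itv/= lt0y addye.
rewrite -(fubini_tonelli (fun z : mR * T => (\1_D z)%:E))//=; last first.
  by apply/measurable_EFinP.
rewrite [RHS]integral_mkcond/=; apply: eq_integral => t _.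
have -> : (fun x : T => (\1_D (t, x))%:E) =
          (fun x : T => (\1_(xsection D t) x)%:E :> \bar R).
  by apply/funext => x; rewrite !indicE /xsection mem_setE.
rewrite integral_indic//=; last exact: measurable_xsection.
rewrite setIT patchE; case: ifPn => [|]; rewrite ?inE/= ?notin_setE/= in_itv/= andbT.
  move=> t0; congr (mu _); apply/seteqP; split => x; rewrite /xsection/= inE/=; first by case.
  by move=> ?; split.
move=> t0; rewrite -[RHS](measure0 mu); congr (mu _).
by apply/seteqP; split => x; rewrite /xsection/= inE//= => -[].
Qed.

End LayerCake.

(** * The Brunn-Minkowski inequality on the line *)

Section BrunnMinkowski1.
Context (R : realType).
Local Notation mR := (measurableTypeR R).
Let leb : {sigma_finite_measure set mR -> \bar R} := @lebesgue_measure R.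
Implicit Types (A B C : set mR) (p : R).
Local Open Scope ereal_scope.

(** Inner regularity restricted to nonempty compact sets, which have a maximum and a minimum. An
    empty competitor contributes 0 and is replaced by a singleton of [A]. *)
Lemma lebesgue_measure_inner_sup A : measurable A -> A !=set0 ->
  leb A = ereal_sup [set leb K | K in [set K | [/\ compact K, K !=set0 & K `<=` A]]].
Proof.
move=> mA [a Aa]; apply/eqP; rewrite eq_le; apply/andP; split; last first.
  apply: ge_ereal_sup => _ [K [cK _ KA] <-].
  by apply: le_measure => //; rewrite inE//; exact: compact_measurable.
rewrite [leLHS]lebesgue_regularity_inner_sup//.
apply: ge_ereal_sup => _ [K [cK KA] <-].
have [->|/set0P K0] := eqVneq K set0.
  rewrite measure0; apply: ereal_sup_ge.
  by exists (leb [set a]) => //; exists [set a] => //; split => [||_ ->//];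
    [exact: compact_set1|exists a].
by apply: ereal_sup_ubound; exists K.
Qed.

(** Let a be the maximum of A and b the minimum of B. The sets (1 - p) A + p b and (1 - p) a + p B
    lie in C, the first to the left and the second to the right of c = (1 - p) a + p b. *)
Lemma brunn_minkowski_compact p A B C : (0 < p < 1)%R ->
  compact A -> compact B -> measurable C -> A !=set0 -> B !=set0 ->
  (forall a b, A a -> B b -> C ((1 - p) * a + p * b)%R) ->
  (1 - p)%:E * leb A + p%:E * leb B <= leb C.
Proof.
move=> /andP[p0 p1] cA cB mC A0 B0 ABC.
have q0 : (0 < 1 - p)%R by rewrite subr_gt0.
have cid (X : set R) : {within X, continuous (@idfun R)}.
  by apply: continuous_subspaceT => x; exact: cvg_id.
have [a Aa Amax] := compact_EVT_max A0 cA (cid A).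
have [b Bb Bmin] := compact_EVT_min B0 cB (cid B).
rewrite !inE in Aa Bb.
have mA : measurable (A : set mR) by exact: compact_measurable.
have mB : measurable (B : set mR) by exact: compact_measurable.
set c := ((1 - p) * a + p * b)%R.
have scale_shift r s D : (0 < r)%R -> measurable D ->
    exists2 E : set mR, measurable E & leb E = r%:E * leb D /\
      E = (fun x => r^-1 * x + (- (s / r)))%R @^-1` D.
  move=> r0 mD; set g := (fun x : mR => r^-1 * x + (- (s / r)) : mR)%R.
  have mE : measurable (g @^-1` D).
    by rewrite -[X in measurable X]setTI; exact: measurable_affine.
  exists (g @^-1` D) => //; split => //.
  have r'0 : (0 < r^-1)%R by rewrite invr_gt0.
  have aff : r^-1%:E * leb (g @^-1` D) = leb D by exact: lebesgue_measure_affine_gt0.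
  by rewrite -aff muleA -EFinM mulfV ?gt_eqF// mul1e.
have [A' mA' [lA' A'E]] := scale_shift _ (p * b)%R _ q0 mA.
have [B' mB' [lB' B'E]] := scale_shift _ ((1 - p) * a)%R _ p0 mB.
have A'C x : A' x -> C x /\ (x <= c)%R.
  rewrite A'E /= => Ax; split.
    have := ABC _ _ Ax Bb; congr C; field; exact: lt0r_neq0.
  have : ((1 - p)^-1 * x + (- (p * b / (1 - p))) <= a)%R := Amax _ (mem_set Ax).
  by rewrite (mulrC _^-1%R) -mulrBl ler_pdivrMr// lerBlDr (mulrC a).
have B'C x : B' x -> C x /\ (c <= x)%R.
  rewrite B'E /= => Bx; split.
    have := ABC _ _ Aa Bx; congr C; field; exact: lt0r_neq0.
  have : (b <= p^-1 * x + (- ((1 - p) * a / p)))%R := Bmin _ (mem_set Bx).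
  by rewrite (mulrC _^-1%R) -mulrBl ler_pdivlMr// lerBrDr addrC (mulrC b).
rewrite -lA' -lB'.
have mA'c : measurable (A' `\ c) by apply: measurableD => //; exact: measurable_set1.
(* The two pieces meet at most in [c]; dropping this null point makes them disjoint, so their
   measures add up. *)
have -> : leb A' = leb (A' `\ c).
  apply/eqP; rewrite eq_le; apply/andP; split; last by apply: le_measure; rewrite ?inE.
  rewrite [leRHS](_ : _ = leb (A' `\ c) + leb [set c]); last first.
    by rewrite [X in _ + X]lebesgue_measure_set1 adde0.
  apply: le_trans (@measureU2 _ _ _ leb _ _ mA'c (measurable_set1 c)).
  apply: le_measure; rewrite ?inE//; first by apply: measurableU.
  by move=> x Ax; have [->|xc] := pselect (x = c); [right|left].
rewrite -measureU//; last first.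
  apply/seteqP; split => x //= [[Ax xc] Bx]; apply: xc.
  by apply/eqP; rewrite eq_le (A'C _ Ax).2 (B'C _ Bx).2.
apply: le_measure; rewrite ?inE//; first exact: measurableU.
by move=> x [[/A'C[]]//|/B'C[]].
Qed.

Lemma brunn_minkowski1 p A B C : (0 < p < 1)%R ->
  measurable A -> measurable B -> measurable C -> A !=set0 -> B !=set0 ->
  (forall a b, A a -> B b -> C ((1 - p) * a + p * b)%R) ->
  (1 - p)%:E * leb A + p%:E * leb B <= leb C.
Proof.
move=> p01 mA mB mC A0 B0 ABC; have /andP[p0 p1] := p01.
have q0 : (0 < 1 - p)%R by rewrite subr_gt0.
rewrite (lebesgue_measure_inner_sup mA A0) (lebesgue_measure_inner_sup mB B0).
have [[a Aa] [b Bb]] := (A0, B0).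
have ne X (x : R) : X x ->
    [set leb K | K in [set K | [/\ compact K, K !=set0 & K `<=` X]]] !=set0.
  move=> Xx; exists (leb [set x]); exists [set x] => //; split => [||_ ->//].
    exact: compact_set1.
  by exists x.
apply: ereal_sup_mull_le => //.
- rewrite gt_eqF// (lt_le_trans ltNy0)// mule_ge0// ?lee_fin ?(ltW p0)//.
  by have [x Sx] := ne _ _ Bb; apply: le_trans (ereal_sup_ubound Sx); case: Sx => K _ <-.
- exact: ne Aa.
- by move=> _ [K _ <-].
move=> _ [K [cK K0 KA] <-]; rewrite addeC; apply: ereal_sup_mull_le => //.
- by rewrite gt_eqF// (lt_le_trans ltNy0)// mule_ge0// ?lee_fin ?(ltW q0).
- exact: ne Bb.
- by move=> _ [L _ <-].
move=> _ [L [cL L0 LB] <-]; rewrite addeC; apply: brunn_minkowski_compact => //.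
by move=> x y Kx Ly; apply: ABC; [exact: KA|exact: LB].
Qed.

End BrunnMinkowski1.

(** * Truncation of nonnegative functions *)

Section IntegralTruncation.
Context d (T : measurableType d) (R : realType) (mu : {measure set T -> \bar R}).
Local Open Scope ereal_scope.

Lemma integral_mine_sup (F : T -> \bar R) : measurable_fun setT F ->
  (forall x, 0 <= F x) ->
  \int[mu]_x F x =
  ereal_sup (range (fun n : nat => \int[mu]_x mine (F x) n%:R%:E)).
Proof.
move=> mF F0.
have ndF x : nondecreasing_seq (fun n : nat => mine (F x) n%:R%:E).
  by move=> m n mn; rewrite le_min !ge_min lexx/= lee_fin ler_nat mn orbT.
have mFn (n : nat) : measurable_fun setT (fun x => mine (F x) n%:R%:E).
  by apply: measurable_mine.
have Fn0 (n : nat) x : 0 <= mine (F x) n%:R%:E by rewrite le_min F0 lee_fin ler0n.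
transitivity (\int[mu]_x limn (fun n : nat => mine (F x) n%:R%:E)).
  apply: eq_integral => x _; apply/esym/cvg_lim => //.
  have supF : ereal_sup (range (fun n : nat => mine (F x) n%:R%:E)) = F x.
    apply/eqP; rewrite eq_le; apply/andP; split.
      by apply: ge_ereal_sup => _ [n _ <-]; rewrite ge_min lexx.
    have := F0 x; case: (F x) => [r|_|//].
      rewrite lee_fin => r0; apply: le_ereal_sup_tmp.
      exists (mine r%:E (Num.truncn r).+1%:R%:E); first by exists (Num.truncn r).+1.
      by rewrite le_min lexx/= lee_fin ltW// truncnS_gt.
    rewrite leye_eq; apply/eqP/eq_infty => r; apply: le_ereal_sup_tmp.
    exists (mine +oo (Num.truncn r).+1%:R%:E); first by exists (Num.truncn r).+1.
    by rewrite le_min leey lee_fin ltW// truncnS_gt.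
  by have := ereal_nondecreasing_cvgn (ndF x); rewrite supF.
rewrite monotone_convergence//.
apply/cvg_lim => //; apply: ereal_nondecreasing_cvgn => m n mn.
by apply: ge0_le_integral => // x _; exact: ndF.
Qed.

End IntegralTruncation.

(** * The Prekopa-Leindler inequality on the line *)

Section PrekopaLeindler1.
Context (R : realType).
Local Notation mR := (measurableTypeR R).
Let leb : {sigma_finite_measure set mR -> \bar R} := @lebesgue_measure R.
Implicit Types (F G H : mR -> \bar R) (p : R).
Local Open Scope ereal_scope.

(** Compare the layer cake integrands height by height. Below height 1 the superlevel sets of [F]
    and [G] are nonempty, as Brunn-Minkowski demands; from height 1 on they are empty and the left
    side is 0. *)
Lemma prekopa_leindler1_normalized p F G H : (0 < p < 1)%R ->
  measurable_fun setT F -> measurable_fun setT G -> measurable_fun setT H ->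
  (forall x, 0 <= F x <= 1) -> (forall x, 0 <= G x <= 1) -> (forall x, 0 <= H x) ->
  (forall t : R, (t < 1)%R -> exists x, t%:E < F x) ->
  (forall t : R, (t < 1)%R -> exists x, t%:E < G x) ->
  (forall x y, F x `^ (1 - p) * G y `^ p <= H ((1 - p) * x + p * y)%R) ->
  (1 - p)%:E * \int[leb]_x F x + p%:E * \int[leb]_x G x <= \int[leb]_x H x.
Proof.
move=> p01 mF mG mH F01 G01 H0 supF supG FGH; have /andP[p0 p1] := p01.
have q0 : (0 < 1 - p)%R by rewrite subr_gt0.
have F0 x : 0 <= F x by have /andP[] := F01 x.
have G0 x : 0 <= G x by have /andP[] := G01 x.
rewrite !layer_cake//.
have mS (K : mR -> \bar R) : measurable_fun setT K ->
    measurable_fun (`[0%R, +oo[%classic : set mR)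
    (fun t : mR => leb [set x | t%:E < K x]).
  by move=> mK; apply: measurable_funTS; exact: measurable_superlevel.
rewrite -!ge0_integralZl//;
  [|exact: mS|by rewrite lee_fin ltW|exact: mS|by rewrite lee_fin ltW].
rewrite -ge0_integralD//; last 4 first.
- by move=> t _; rewrite mule_ge0// lee_fin ltW.
- by apply: measurable_funeM; exact: mS.
- by move=> t _; rewrite mule_ge0// lee_fin ltW.
- by apply: measurable_funeM; exact: mS.
apply: ge0_le_integral => //.
- by move=> t _; rewrite adde_ge0// mule_ge0// lee_fin ltW.
- by apply: emeasurable_funD; apply: measurable_funeM; exact: mS.
- exact: mS.
move=> t /=; rewrite in_itv/= andbT => t0.
have [t1|t1] := ltP t 1%R; last first.
  have empty (K : mR -> \bar R) : (forall x, 0 <= K x <= 1) -> leb [set x | t%:E < K x] = 0.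
    move=> K01; rewrite [X in leb X](_ : _ = set0) ?measure0//.
    apply/seteqP; split => x //=; rewrite ltNge => /negP; apply.
    by have /andP[_ /le_trans] := K01 x; apply; rewrite lee_fin.
  by rewrite (empty F)// (empty G)// !mule0 adde0 measure_ge0.
have mset (K : mR -> \bar R) : measurable_fun setT K -> measurable [set x | t%:E < K x].
  move=> mK; rewrite -[X in measurable X]setTI.
  exact: measurable_lte.
apply: brunn_minkowski1 => //; [exact: mset|exact: mset|exact: mset|exact: supF|exact: supG|].
move=> x y /= tF tG; apply: lt_le_trans (FGH x y).
(* A weighted geometric mean is at least the minimum, so the combined point lies in the superlevel
   set of [H]. *)
set m := mine (F x) (G y).
have m0 : 0 <= m by rewrite le_min F0 G0.
apply: (@lt_le_trans _ _ m); first by rewrite lt_min tF tG.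
have -> : m = m `^ (1 - p) * m `^ p.
  by rewrite -poweRD ?subrK ?poweRe1// add_neq0_poweRD_def// subrK oner_neq0.
by apply: lee_pmul; rewrite ?poweR_ge0//; apply: gt0_ler_poweR;
  rewrite ?in_itv/= ?leey ?andbT ?(ltW p0) ?(ltW q0)// ge_min lexx ?orbT.
Qed.

(** The bounds make the suprema a of [F] and b of [G] finite. Either one is 0 and its integral
    vanishes, or dividing [F], [G], [H] by a, b and a^(1 - p) b^p reaches the normalized case. *)
Lemma prekopa_leindler1_bounded p F G H (M N : R) : (0 < p < 1)%R ->
  measurable_fun setT F -> measurable_fun setT G -> measurable_fun setT H ->
  (forall x, 0 <= F x <= M%:E) -> (forall x, 0 <= G x <= N%:E) ->
  (forall x, 0 <= H x) ->
  (forall x y, F x `^ (1 - p) * G y `^ p <= H ((1 - p) * x + p * y)%R) ->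
  (\int[leb]_x F x) `^ (1 - p) * (\int[leb]_x G x) `^ p <= \int[leb]_x H x.
Proof.
move=> p01 mF mG mH F01 G01 H0 FGH; have /andP[p0 p1] := p01.
have q0 : (0 < 1 - p)%R by rewrite subr_gt0.
have intH : 0 <= \int[leb]_x H x by exact: integral_ge0.
have normalize (K : mR -> \bar R) (L : R) : measurable_fun setT K ->
    (forall x, 0 <= K x <= L%:E) -> \int[leb]_x K x = 0 \/
    exists a : R, [/\ (0 < a)%R, forall x, 0 <= a^-1%:E * K x <= 1 &
      forall t : R, (t < 1)%R -> exists x, t%:E < a^-1%:E * K x].
  move=> mK K0L.
  have K0 x : 0 <= K x by have /andP[] := K0L x.
  have [s sE] : {s | s = ereal_sup (range K)} by eexists.
  have Ks x : K x <= s by rewrite sE; apply: ereal_sup_ubound; exists x.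
  have s0 : 0 <= s by exact: le_trans (K0 0%R) (Ks 0%R).
  have sL : s <= L%:E by rewrite sE; apply: ge_ereal_sup => _ [x _ <-]; have /andP[] := K0L x.
  case: s s0 sL Ks sE => [a| |]//; rewrite !lee_fin le_eqVlt.
  move=> /predU1P[<- _ Ks _|a0 _ Ks sE]; [left|right].
    by apply: integral0_eq => x _; apply/eqP; rewrite eq_le Ks K0.
  exists a; split => // [x|t t1].
    by rewrite mule_ge0 ?lee_fin ?invr_ge0 ?(ltW a0)//= lee_pdivrMl// mule1.
  apply: contrapT => nx.
  suff : ereal_sup (range K) <= (a * t)%:E by rewrite -sE lee_fin ler_pMr// leNgt t1.
  apply: ge_ereal_sup => _ [x _ <-].
  rewrite EFinM -lee_pdivrMl// leNgt; apply/negP => tx.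
  by apply: nx; exists x.
have [->|[a [a0 Fa supF]]] := normalize F M mF F01.
  by rewrite poweR0r ?gt_eqF// mul0e.
have [->|[b [b0 Gb supG]]] := normalize G N mG G01.
  by rewrite poweR0r ?gt_eqF// mule0.
set m := (a `^ (1 - p) * b `^ p)%R.
have m0 : (0 < m)%R by rewrite mulr_gt0// powR_gt0.
have scaleE X Y : 0 <= X -> 0 <= Y ->
    (a^-1%:E * X) `^ (1 - p) * (b^-1%:E * Y) `^ p =
    m^-1%:E * (X `^ (1 - p) * Y `^ p).
  move=> X0 Y0; rewrite !poweRM// ?lee_fin ?invr_ge0 ?(ltW a0) ?(ltW b0)//.
  rewrite !poweR_EFin muleACA -EFinM; congr (_%:E * _).
  rewrite invfM -!powR_inv1 ?powR_ge0 ?(ltW a0) ?(ltW b0)// -!powRrM.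
  by rewrite (mulrC _ (- _))%R (mulrC p).
have F0 x : 0 <= F x by have /andP[] := F01 x.
have G0 x : 0 <= G x by have /andP[] := G01 x.
have := @prekopa_leindler1_normalized p (fun x => a^-1%:E * F x)
  (fun x => b^-1%:E * G x) (fun x => m^-1%:E * H x) p01.
rewrite !ge0_integralZl_EFin// ?invr_ge0 ?(ltW a0) ?(ltW b0) ?(ltW m0)//.
move=> PL; rewrite -(lee_pmul2l (x := m^-1%:E))// ?lte_fin ?invr_gt0//.
rewrite -scaleE ?integral_ge0//.
apply: le_trans (weighted_AGM p01 _ _) _.
- by rewrite mule_ge0 ?lee_fin ?invr_ge0 ?(ltW a0)// integral_ge0.
- by rewrite mule_ge0 ?lee_fin ?invr_ge0 ?(ltW b0)// integral_ge0.
apply: PL => //.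
- exact: measurable_funeM.
- exact: measurable_funeM.
- exact: measurable_funeM.
- by move=> x; rewrite mule_ge0 ?lee_fin ?invr_ge0 ?(ltW m0).
move=> x y; rewrite scaleE//; apply: lee_wpmul2l => //.
by rewrite lee_fin invr_ge0 ltW.
Qed.

(** Truncating [F] and [G] only lowers the left side of the hypothesis, so [H] is kept; the
    integrals are the suprema of those of the truncations. *)
Lemma prekopa_leindler1 p F G H : (0 < p < 1)%R ->
  measurable_fun setT F -> measurable_fun setT G -> measurable_fun setT H ->
  (forall x, 0 <= F x) -> (forall x, 0 <= G x) -> (forall x, 0 <= H x) ->
  (forall x y, F x `^ (1 - p) * G y `^ p <= H ((1 - p) * x + p * y)%R) ->
  (\int[leb]_x F x) `^ (1 - p) * (\int[leb]_x G x) `^ p <= \int[leb]_x H x.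
Proof.
move=> p01 mF mG mH F0 G0 H0 FGH; have /andP[p0 p1] := p01.
have q0 : (0 < 1 - p)%R by rewrite subr_gt0.
have ne (f : nat -> \bar R) : range f !=set0 by exists (f 0%N); exists 0%N.
have Kn0 (K : mR -> \bar R) (n : nat) x : (forall x, 0 <= K x) ->
    0 <= mine (K x) n%:R%:E.
  by move=> K0; rewrite le_min K0 lee_fin ler0n.
have intKn0 (K : mR -> \bar R) (n : nat) : (forall x, 0 <= K x) ->
    0 <= \int[leb]_x mine (K x) n%:R%:E.
  by move=> K0; apply: integral_ge0 => x _; exact: Kn0.
rewrite (integral_mine_sup leb mF F0) (integral_mine_sup leb mG G0).
apply: poweR_sup_mulr_le => //.
- exact: poweR_ge0.
- exact: integral_ge0.
- by move=> _ [n _ <-]; exact: intKn0.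
move=> _ [n _ <-]; rewrite muleC; apply: poweR_sup_mulr_le => //.
- exact: poweR_ge0.
- exact: integral_ge0.
- by move=> _ [k _ <-]; exact: intKn0.
move=> _ [k _ <-]; rewrite muleC.
apply: (@prekopa_leindler1_bounded _ _ _ _ n%:R k%:R) => //.
- exact: measurable_mine.
- exact: measurable_mine.
- by move=> x; rewrite Kn0//= ge_min lexx orbT.
- by move=> x; rewrite Kn0//= ge_min lexx orbT.
move=> x y; apply: le_trans (FGH x y).
have mon (r : R) X Y : (0 < r)%R -> 0 <= X -> X <= Y -> X `^ r <= Y `^ r.
  move=> r0 X0 XY; apply: gt0_ler_poweR => //; first exact: ltW.
    by rewrite in_itv/= X0 leey.
  by rewrite in_itv/= (le_trans X0 XY) leey.
by apply: lee_pmul; rewrite ?poweR_ge0//; apply: mon => //; rewrite ?Kn0// ge_min lexx.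
Qed.

End PrekopaLeindler1.

(** * Integration and linear substitutions on R^n *)

Section TupleMeasure.
Context (R : realType).
Local Notation mR := (measurableTypeR R).
Let leb : {sigma_finite_measure set mR -> \bar R} := @lebesgue_measure R.
Implicit Types (n : nat) (p c : R).
Local Notation mu := (lebesgue_tuple R).
Local Notation consp := (@consp R _).
Local Open Scope ereal_scope.

Lemma integral_lebesgue_tupleS n (f : n.+1.-tuple mR -> \bar R) :
  measurable_fun setT f -> (forall t, 0 <= f t) ->
  \int[mu n.+1]_t f t = \int[leb]_x \int[mu n]_t f (consp (x, t)).
Proof.
move=> mf f0.
have mc : measurable_fun setT (@Defs.consp R n) by exact: measurable_consp.
transitivity (\int[leb \x mu n]_z f (consp z)).
  rewrite -[RHS]/(\int[leb \x mu n]_z (f \o @Defs.consp R n) z).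
  by rewrite -(ge0_integral_pushforward mc (leb \x mu n)%E measurableT mf) ?preimage_setT.
rewrite (fubini_tonelli1 (fun z => f (consp z)))//.
exact: measurableT_comp.
Qed.

Lemma measurable_integral_consp n (f : n.+1.-tuple mR -> \bar R) :
  measurable_fun setT f -> (forall t, 0 <= f t) ->
  measurable_fun setT (fun x : mR => \int[mu n]_t f (consp (x, t))).
Proof.
move=> mf f0.
apply: (measurable_fun_fubini_tonelli_F (fun z => f (consp z))) => //.
by apply: measurableT_comp => //; exact: measurable_consp.
Qed.

Lemma measurable_preimage_consp n (A : set (n.+1.-tuple mR)) : measurable A ->
  measurable (@Defs.consp R n @^-1` A).
Proof. by move=> mA; rewrite -[X in measurable X]setTI; exact: measurable_consp. Qed.

Lemma measurable_consp_section n (A : set (n.+1.-tuple mR)) (x : mR) :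
  measurable A -> measurable [set t | A (consp (x, t))].
Proof.
move=> /measurable_preimage_consp /(@measurable_xsection _ _ _ _ _ x).
by congr measurable; apply/seteqP; split => t; rewrite /xsection/= inE.
Qed.

Lemma lebesgue_tupleS n (A : set (n.+1.-tuple mR)) : measurable A ->
  mu n.+1 A = \int[leb]_x mu n [set t | A (consp (x, t))].
Proof.
move=> mA; rewrite -[LHS]/((leb \x mu n) (@Defs.consp R n @^-1` A)).
rewrite /product_measure1; apply: eq_integral => x _ /=; congr (mu n _).
by apply/seteqP; split => t; rewrite /xsection/= inE.
Qed.

(** Tonelli with the first coordinate innermost, the order suited to fibres parallel to the first
    axis. *)
Lemma lebesgue_tupleS_swap n (A : set (n.+1.-tuple mR)) : measurable A ->
  mu n.+1 A = \int[mu n]_t leb [set x | A (consp (x, t))].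
Proof.
move=> mA; have mA' := measurable_preimage_consp mA.
transitivity (\int[leb \x mu n]_z (\1_(@Defs.consp R n @^-1` A) z)%:E).
  by rewrite integral_indic// setIT.
rewrite (fubini_tonelli2 (fun z => (\1_(@Defs.consp R n @^-1` A) z)%:E))//; last first.
  by apply/measurable_EFinP.
apply: eq_integral => t _.
rewrite -[X in leb X]setIT -integral_indic//=; last first.
  have := @measurable_ysection _ _ _ _ _ t mA'.
  by congr measurable; apply/seteqP; split => x; rewrite /ysection/= inE.
Qed.

Definition tuple_comb n p (s t : n.-tuple mR) : n.-tuple mR :=
  [tuple (1 - p) * tnth s i + p * tnth t i | i < n]%R.

Lemma tuple_comb_consp n p (x y : mR) (s t : n.-tuple mR) :
  tuple_comb p (consp (x, s)) (consp (y, t)) =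
  consp (((1 - p) * x + p * y)%R, tuple_comb p s t).
Proof.
apply: eq_from_tnth => i; rewrite tnth_mktuple.
case: (unliftP ord0 i) => [j|] ->; last by rewrite /Defs.consp !tnth0.
by rewrite /Defs.consp !tnthS tnth_mktuple.
Qed.

(** For fixed first coordinates x and y, the induction hypothesis on the sections is exactly the
    hypothesis of the one-dimensional case for the marginals. In dimension 0 the claim is the
    hypothesis at the only point. *)
Lemma prekopa_leindler n p (f g h : n.-tuple mR -> \bar R) : (0 < p < 1)%R ->
  measurable_fun setT f -> measurable_fun setT g -> measurable_fun setT h ->
  (forall t, 0 <= f t) -> (forall t, 0 <= g t) -> (forall t, 0 <= h t) ->
  (forall s t, f s `^ (1 - p) * g t `^ p <= h (tuple_comb p s t)) ->
  (\int[mu n]_t f t) `^ (1 - p) * (\int[mu n]_t g t) `^ p <= \int[mu n]_t h t.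
Proof.
move=> p01; elim: n f g h => [|n IH] f g h mf mg mh f0 g0 h0 fgh.
  rewrite /lebesgue_tuple !integral_dirac// !diracT !mul1e.
  by apply: le_trans (fgh _ _) _; rewrite (tuple0 (tuple_comb _ _ _)).
rewrite !integral_lebesgue_tupleS//.
have mc (k : n.+1.-tuple mR -> \bar R) x : measurable_fun setT k ->
    measurable_fun setT (fun t => k (consp (x, t))).
  move=> mk; apply: measurableT_comp => //.
  by apply: (@measurable_cons _ _ _ _ (fun=> x) n id).
apply: prekopa_leindler1 => //; try exact: measurable_integral_consp;
  try (by move=> x; apply: integral_ge0 => t _).
move=> x y; apply: IH => //; try exact: mc.
by move=> s t; rewrite -tuple_comb_consp; exact: fgh.
Qed.

Definition tuple_affine n c (v t : n.-tuple mR) : n.-tuple mR :=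
  [tuple c * tnth t i + tnth v i | i < n]%R.

Lemma measurable_tuple_affine n c (v : n.-tuple mR) :
  measurable_fun setT (tuple_affine c v).
Proof.
apply/measurable_fun_tnthP => i.
rewrite (_ : _ \o _ = fun t : n.-tuple mR => (c * tnth t i + tnth v i : mR)%R); last first.
  by apply/funext => t /=; rewrite tnth_mktuple.
apply: measurable_funD => //; apply: measurable_funM => //.
exact: measurable_tnth.
Qed.

Lemma lebesgue_tuple_affine n c (v : n.-tuple mR) A : (0 < c)%R ->
  measurable A -> (c ^+ n)%:E * mu n (tuple_affine c v @^-1` A) = mu n A.
Proof.
move=> c0; elim: n v A => [|n IH] v A mA.
  rewrite expr0 mul1e; congr (mu 0%N _); apply/seteqP.
  by split => t /=; rewrite (tuple0 (tuple_affine _ _ _)) (tuple0 t).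
have mA' : measurable (tuple_affine c v @^-1` A).
  by rewrite -[X in measurable X]setTI; exact: measurable_tuple_affine.
rewrite !lebesgue_tupleS//.
pose w := [tuple of behead v].
have consE x t : tuple_affine c v (consp (x, t)) =
    consp ((c * x + thead v)%R, tuple_affine c w t).
  apply: eq_from_tnth => i; rewrite tnth_mktuple.
  case: (unliftP ord0 i) => [j|] ->; last by rewrite /Defs.consp !tnth0.
  rewrite /Defs.consp !tnthS tnth_mktuple tnth_behead.
  by congr (_ + tnth v _)%R; apply: val_inj => /=; rewrite inordK ?ltnS.
have mF : measurable_fun setT (fun x : mR => mu n [set t | A (consp (x, t))]).
  have := measurable_fun_xsection (mu n) (measurable_preimage_consp mA).
  congr measurable_fun; apply/funext => x /=; congr (mu n _).
  by apply/seteqP; split => t; rewrite /xsection/= inE.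
rewrite -[RHS](@integral_affine _ c (thead v))//; last exact: lt0r_neq0.
rewrite gtr0_norm// exprSr EFinM (muleC _ c%:E) -muleA; congr (_ * _).
have cn0 : (0 <= c ^+ n)%R by rewrite exprn_ge0// ltW.
rewrite -ge0_integralZl_EFin//.
- apply: eq_integral => x _.
  rewrite -[RHS](IH w)//; last exact: measurable_consp_section.
  by congr (_ * mu n _); apply/seteqP; split => t /=; rewrite consE.
- have := measurable_fun_xsection (mu n) (measurable_preimage_consp mA').
  congr measurable_fun; apply/funext => x /=; congr (mu n _).
  by apply/seteqP; split => t; rewrite /xsection/= inE.
Qed.

(** The linear shear that fixes the hyperplane of zero first coordinate and sends the first basis
    vector to (1, w): lines parallel to the first axis become lines parallel to (1, w). *)
Definition tuple_shear n (w : n.-tuple mR) (u : n.+1.-tuple mR) : n.+1.-tuple mR :=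
  consp (thead u, tuple_affine 1 [tuple thead u * tnth w i | i < n]%R [tuple of behead u]).

Lemma measurable_tuple_shear n (w : n.-tuple mR) :
  measurable_fun setT (tuple_shear w).
Proof.
apply: measurable_cons => /=; first exact: measurable_tnth.
apply/measurable_fun_tnthP => i.
rewrite (_ : _ \o _ = fun t : n.+1.-tuple mR =>
    (tnth t (lift ord0 i) + tnth t ord0 * tnth w i : mR)%R); last first.
  apply/funext => t /=; rewrite !tnth_mktuple mul1r tnth_behead.
  by congr (tnth t _ + _)%R; apply: val_inj => /=; rewrite inordK ?ltnS.
apply: measurable_funD; first exact: measurable_tnth.
by apply: measurable_funM => //; exact: measurable_tnth.
Qed.

(** On each slice of constant first coordinate the shear is a translation. *)
Lemma lebesgue_tuple_shear n (w : n.-tuple mR) A : measurable A ->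
  mu n.+1 (tuple_shear w @^-1` A) = mu n.+1 A.
Proof.
move=> mA.
have mA' : measurable (tuple_shear w @^-1` A).
  by rewrite -[X in measurable X]setTI; exact: measurable_tuple_shear.
rewrite !lebesgue_tupleS//; apply: eq_integral => x _.
rewrite -[RHS](@lebesgue_tuple_affine n 1 [tuple x * tnth w i | i < n]%R)//; last first.
  exact: measurable_consp_section.
rewrite expr1n mul1e; congr (mu n _); apply/seteqP.
have e t : [tuple of behead (consp (x, t))] = t by apply: val_inj.
by split => t /=; rewrite /tuple_shear theadE e.
Qed.

End TupleMeasure.

(** * Convex bodies and their volume *)

Section Euclidean.
Context (R : realType) (n : nat).
Implicit Types (x y z u v : 'rV[R]_n) (K L : set 'rV[R]_n) (c s t : R).

Definition dot x y : R := \sum_(i < n) x ord0 i * y ord0 i.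
Definition sqn x : R := \sum_(i < n) x ord0 i ^+ 2.
Definition enorm x : R := Num.sqrt (sqn x).

Lemma sqnE x : sqn x = dot x x.
Proof. by apply: eq_bigr => i _; rewrite expr2. Qed.

Lemma dotC x y : dot x y = dot y x.
Proof. by apply: eq_bigr => i _; rewrite mulrC. Qed.

Lemma dotDl x y z : dot (x + y) z = dot x z + dot y z.
Proof. by rewrite /dot -big_split; apply: eq_bigr => i _; rewrite mxE mulrDl. Qed.

Lemma dotZl c x y : dot (c *: x) y = c * dot x y.
Proof. by rewrite /dot mulr_sumr; apply: eq_bigr => i _; rewrite mxE mulrA. Qed.

Lemma dotDr x y z : dot x (y + z) = dot x y + dot x z.
Proof. by rewrite !(dotC x) dotDl. Qed.

Lemma dotZr c x y : dot x (c *: y) = c * dot x y.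
Proof. by rewrite !(dotC x) dotZl. Qed.

Lemma dotNl x y : dot (- x) y = - dot x y.
Proof. by rewrite -scaleN1r dotZl mulN1r. Qed.

Lemma dotNr x y : dot x (- y) = - dot x y.
Proof. by rewrite !(dotC x) dotNl. Qed.

Lemma sqn_ge0 x : 0 <= sqn x.
Proof. by apply: sumr_ge0 => i _; exact: sqr_ge0. Qed.

Lemma sqn_eq0 x : sqn x = 0 -> x = 0.
Proof.
move=> /eqP; rewrite psumr_eq0 => [/allP x0|i _]; last exact: sqr_ge0.
apply/rowP => i; rewrite mxE; apply/eqP; rewrite -sqrf_eq0.
by have := x0 i (mem_index_enum _).
Qed.

Lemma sqnZ c x : sqn (c *: x) = c ^+ 2 * sqn x.
Proof. by rewrite !sqnE dotZl dotZr mulrA expr2. Qed.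

Lemma sqnD x y : sqn (x + y) = sqn x + 2 * dot x y + sqn y.
Proof. by rewrite !sqnE !dotDl !dotDr (dotC y x); ring. Qed.

Lemma enorm_ge0 x : 0 <= enorm x. Proof. exact: sqrtr_ge0. Qed.

Lemma enorm_sqr x : enorm x ^+ 2 = sqn x.
Proof. by rewrite sqr_sqrtr// sqn_ge0. Qed.

Lemma cauchy_schwarz x y : dot x y <= enorm x * enorm y.
Proof.
apply: le_trans (ler_norm _) _.
rewrite -(ler_pXn2r (n := 2))// ?nnegrE// ?mulr_ge0 ?enorm_ge0//.
rewrite exprMn !enorm_sqr real_normK ?num_real//.
have [/sqn_eq0 ->|y0] := eqVneq (sqn y) 0.
  have -> : dot x 0 = 0 by rewrite -(scale0r 0) dotZr mul0r.
  by rewrite expr0n/= mulr_ge0// sqn_ge0.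
have yp : 0 < sqn y by rewrite lt0r y0 sqn_ge0.
have := sqn_ge0 (sqn y *: x - dot x y *: y).
rewrite sqnD -scaleN1r !sqnZ !dotZr dotZl => h.
rewrite -(ler_pM2l yp) -subr_ge0; apply: le_trans h _.
by rewrite le_eqVlt; apply/orP; left; apply/eqP; ring.
Qed.

Lemma abs_coord_le_enorm x i : `|x ord0 i| <= enorm x.
Proof.
rewrite -(ler_pXn2r (n := 2))// ?nnegrE// ?enorm_ge0// enorm_sqr real_normK ?num_real//.
by rewrite /sqn (bigD1 i)//= lerDl; apply: sumr_ge0 => j _; exact: sqr_ge0.
Qed.

Lemma sqn_convex c x y : 0 <= c <= 1 ->
  sqn ((1 - c) *: x + c *: y) <= (1 - c) * sqn x + c * sqn y.
Proof.
move=> /andP[c0 c1]; rewrite /sqn !mulr_sumr -big_split/=.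
apply: ler_sum => i _; rewrite !mxE -subr_ge0.
rewrite (_ : _ - _ = (1 - c) * c * (x ord0 i - y ord0 i) ^+ 2); last by ring.
by rewrite mulr_ge0 ?sqr_ge0// mulr_ge0// subr_ge0.
Qed.

Lemma continuous_sqn_sub x : continuous (fun y => sqn (x - y)).
Proof.
rewrite /sqn; apply: (@continuous_big R^o _ +%R) => [|i _ y]; first exact: add_continuous.
have -> : (fun y : 'rV[R]_n => (x - y) ord0 i ^+ 2) =
    (fun t : R => (x ord0 i - t) ^+ 2) \o (fun y : 'rV[R]_n => y ord0 i).
  by apply/funext => z /=; rewrite !mxE.
apply: continuous_comp; first exact: coord_continuous.
apply: (@continuous_comp _ _ _ (fun t : R => x ord0 i - t) (fun t : R => t ^+ 2)).
  by apply: (@cvgB _ R^o); [exact: cvg_cst|exact: cvg_id].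
exact: exprn_continuous.
Qed.

Lemma convex_setP K : convex_set (K : set (convex_lmodType 'rV[R]_n)) <->
  (forall x y c, K x -> K y -> 0 <= c <= 1 -> K (c *: x + (1 - c) *: y)).
Proof.
split => [cK x y c Kx Ky /andP[c0 c1]|cK x y p]; rewrite ?inE.
  by have := cK x y (Itv01 c0 c1) (mem_set Kx) (mem_set Ky); rewrite inE.
move=> Kx Ky; apply: (cK x y p%:num) => //.
by rewrite ge0 le1.
Qed.

Lemma convex_bodyP K : convex_body K <-> [/\ K !=set0, compact K &
  forall x y c, K x -> K y -> 0 <= c <= 1 -> K (c *: x + (1 - c) *: y)].
Proof. by split => -[? ? /convex_setP]. Qed.

Lemma convex_body_minkowski_sum K L : convex_body K -> convex_body L ->
  convex_body (minkowski_sum K L).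
Proof.
move=> /convex_bodyP[[x Kx] cK vK] /convex_bodyP[[y Ly] cL vL].
apply/convex_bodyP; split.
- by exists (x + y), x => //; exists y.
- have -> : minkowski_sum K L = (fun z : 'rV[R]_n * 'rV[R]_n => z.1 + z.2) @` (K `*` L).
    apply/seteqP; split => [_ [a Ka [b Lb <-]]|_ [[a b] [/= Ka Lb] <-]].
      by exists (a, b).
    by exists a => //; exists b.
  apply: continuous_compact; last exact: compact_setX.
  by apply: continuous_subspaceT; exact: add_continuous.
move=> _ _ c [a Ka [b Lb <-]] [a' Ka' [b' Lb' <-]] c01.
exists (c *: a + (1 - c) *: a'); first exact: vK.
exists (c *: b + (1 - c) *: b'); first exact: vL.
by rewrite !scalerDr addrACA.
Qed.

Lemma convex_body_dilate c K : convex_body K -> convex_body (dilate c K).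
Proof.
move=> /convex_bodyP[[x Kx] cK vK]; apply/convex_bodyP; split.
- by exists (c *: x), x.
- by apply: continuous_compact => //; apply: continuous_subspaceT; exact: scaler_continuous.
move=> _ _ s [a Ka <-] [b Kb <-] s01.
exists (s *: a + (1 - s) *: b); first exact: vK.
by rewrite scalerDr !scalerA !(mulrC c).
Qed.

Lemma convex_body_ball : convex_body (@euclidean_ball R n).
Proof.
have sqn0 : sqn (0 : 'rV[R]_n) = 0 by rewrite sqnE -(scale0r 0) dotZl mul0r.
have e : @euclidean_ball R n = (fun y => sqn (0 - y)) @^-1` `]-oo, 1].
  by apply/seteqP; split => x /=; rewrite in_itv/= sub0r -scaleN1r sqnZ sqrrN expr1n mul1r.
apply/convex_bodyP; split.
- by exists 0; rewrite /euclidean_ball /mkset -[X in X <= _]/(sqn 0) sqn0.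
- apply: (@subclosed_compact _ _ [set v : 'rV[R]_n | forall i, `[-1, 1]%classic (v ord0 i)]).
  + rewrite e; move/continuous_closedP : (@continuous_sqn_sub 0); apply.
    exact: interval_closed.
  + by apply: (@rV_compact R n (fun=> `[-1, 1]%classic)) => i; exact: segment_compact.
  + move=> x /= xB i; rewrite in_itv/= -ler_norml.
    apply: le_trans (abs_coord_le_enorm x i) _.
    by rewrite -(sqrtr1 R) ler_sqrt.
move=> x y c xB yB /andP[c0 c1].
have c01 : 0 <= 1 - c <= 1 by rewrite subr_ge0 c1/= lerBlDr lerDl.
have := sqn_convex x y c01; rewrite opprB addrCA subrr addr0 => /le_trans; apply.
rewrite [leRHS](_ : 1 = c * 1 + (1 - c) * 1); last by ring.
by rewrite lerD// ler_wpM2l// subr_ge0.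
Qed.

Definition sseg v : set 'rV[R]_n := [set s *: v | s in `[-1, 1]].

Lemma convex_body_sseg v : convex_body (sseg v).
Proof.
apply/convex_bodyP; split.
- by exists (0 *: v), 0 => //=; rewrite in_itv/= lerN10 ler01.
- apply: continuous_compact; last exact: segment_compact.
  by apply: continuous_subspaceT; exact: scalel_continuous.
move=> _ _ c [a Ka <-] [b Kb <-] /andP[c0 c1].
exists (c * a + (1 - c) * b); last by rewrite [LHS]scalerDl !scalerA.
move: Ka Kb; rewrite /= !in_itv/= => /andP[a1 a2] /andP[b1 b2].
by apply/andP; split; nra.
Qed.

Lemma nearest_point K x : K !=set0 -> compact K ->
  exists2 y, K y & forall z, K z -> sqn (x - y) <= sqn (x - z).
Proof.
move=> K0 cK.
have [|y] := @EVT_min_rV R n (fun y => sqn (x - y)) K K0 cK.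
  by apply: continuous_subspaceT; exact: continuous_sqn_sub.
by rewrite inE => Ky ymin; exists y => // z Kz; apply: ymin; rewrite inE.
Qed.

End Euclidean.

(** * Measurability and volume of sets of row vectors *)

Section Volume.
Context (R : realType).
Local Notation mR := (measurableTypeR R).
Local Notation mu := (lebesgue_tuple R).
Implicit Types (n : nat) (c : R).

Definition row_of_tuple n (t : n.-tuple mR) : 'rV[R]_n := \row_i tnth t i.

Definition tuple_of_row n (x : 'rV[R]_n) : n.-tuple mR := [tuple x ord0 i | i < n].

(** Links the topology of row vectors to the product sigma-algebra of tuples: an open set is the
    union of the countably many sup-norm boxes with rational centre and radius 1 / (k + 1) that it
    contains. *)
Lemma open_measurable_row n (A : set 'rV[R]_n) : open A ->
  measurable (@row_of_tuple n @^-1` A).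
Proof.
move=> oA.
pose box (qk : n.-tuple rat * nat) : set (n.-tuple mR) :=
  [set t | forall i, `|tnth t i - ratr (tnth qk.1 i)| < qk.2.+1%:R^-1].
pose F qk := if `[< box qk `<=` @row_of_tuple n @^-1` A >] then box qk else set0.
have -> : @row_of_tuple n @^-1` A = \bigcup_qk F qk.
  apply/seteqP; split => [t At|t [qk _]]; last first.
    by rewrite /F; case: ifPn => // /asboolP sub /sub.
  have /nbhs_ballP[e /= e0 eA] := oA _ At.
  (* The radius 1 / (k + 1) is below e / 2, so a box of this radius containing [t] stays within
     distance e of [t]. *)
  pose k := Num.truncn (2 / e).
  have ke : k.+1%:R^-1 < e / 2.
    by rewrite -[X in _ < X]invf_div ltf_pV2 ?posrE ?divr_gt0// truncnS_gt.
  have [q qP] : exists q : 'I_n -> rat, forall i, `|tnth t i - ratr (q i)| < k.+1%:R^-1.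
    apply: (@fin_all_exists _ (fun=> rat) (fun i q => `|tnth t i - ratr q| < k.+1%:R^-1)) => i.
    have [|q] := @rat_in_itvoo R (tnth t i - k.+1%:R^-1) (tnth t i).
      by rewrite ltrBlDr ltrDl invr_gt0.
    rewrite in_itv/= => /andP[q1 q2]; exists q.
    by rewrite gtr0_norm ?subr_gt0// ltrBlDr -ltrBlDl.
  exists ([tuple q i | i < n], k) => //; rewrite /F; case: ifPn => [_ i|/asboolP].
    by rewrite /= tnth_mktuple.
  case => s sB; apply: eA; split => // i j.
  rewrite /ball/= !mxE; have := sB j; have := qP j; rewrite /= tnth_mktuple.
  set a := tnth t j; set b := tnth s j; set r := ratr (q j) => aq bq.
  rewrite (_ : a - b = (a - r) - (b - r)); last by ring.
  apply: le_lt_trans (ler_normB _ _) _.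
  by rewrite (splitr e) ltrD// (lt_trans _ ke).
apply: countable_bigcupT_measurable => [|qk]; first exact: countableP.
rewrite /F; case: ifPn => // _.
rewrite (_ : box qk = \bigcap_(i in [set: 'I_n])
    (fun t => tnth t i) @^-1` ball (ratr (tnth qk.1 i) : R) qk.2.+1%:R^-1); last first.
  by apply/seteqP; split => t tB i; [move=> _|]; have := tB i; rewrite /ball/= distrC; apply.
apply: fin_bigcap_measurable => // i _.
by rewrite -[X in measurable X]setTI; apply: measurable_tnth => //; exact: measurable_ball.
Qed.

Lemma closed_measurable_row n (A : set 'rV[R]_n) : closed A ->
  measurable (@row_of_tuple n @^-1` A).
Proof.
move=> cA; rewrite -[A]setCK preimage_setC; apply: measurableC.
exact: (open_measurable_row (closed_openC cA)).
Qed.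

Lemma compact_measurable_row n (A : set 'rV[R]_n) : compact A ->
  measurable (@row_of_tuple n @^-1` A).
Proof.
move=> cA; apply: closed_measurable_row; apply: compact_closed => //.
Qed.

(** Compact sets are bounded in the sup norm and so lie in such a cube, whence their volume is
    finite. *)
Lemma lebesgue_tuple_cube n (M : R) :
  (mu n [set t : n.-tuple mR | forall i, `|tnth t i| <= M]%R < +oo)%E.
Proof.
have mcube k : measurable [set t : k.-tuple mR | forall i, `|tnth t i| <= M].
  rewrite (_ : mkset _ = \bigcap_(i in [set: 'I_k]) (fun t => tnth t i) @^-1` `[-M, M]).
    apply: fin_bigcap_measurable => // i _.
    by rewrite -[X in measurable X]setTI; apply: measurable_tnth.
  apply/seteqP; split => t tB i; [move=> _|]; have := tB i;
    by rewrite /= in_itv/= ler_norml => //; apply.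
elim: n => [|n IH].
  apply: (@le_lt_trans _ _ 1%E); last by rewrite ltry.
  by rewrite /lebesgue_tuple/= diracE lee_fin; case: (_ \in _); rewrite ?ler01.
rewrite lebesgue_tupleS//.
have -> : (\int[lebesgue_measure]_x
    mu n [set t | (forall i, `|tnth (consp (x, t)) i| <= M)%R] =
  \int[@lebesgue_measure R]_(x in `[(- M)%R, M])
    cst (mu n [set t | forall i, `|tnth t i| <= M]%R) x)%E.
  rewrite [RHS]integral_mkcond; apply: eq_integral => x _; rewrite patchE.
  case: ifPn => [|]; rewrite ?inE ?notin_setE/= in_itv/= -ler_norml => xM.
    congr (mu n _); apply/seteqP; split => t tM i.
      by have := tM (lift ord0 i); rewrite /consp tnthS.
    case: (unliftP ord0 i) => [j|] ->; rewrite /consp ?tnthS ?tnth0//.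
  rewrite -[RHS](measure0 (mu n)); congr (mu n _); apply/seteqP; split => t //= tM.
  by apply: xM; have := tM ord0; rewrite /consp tnth0.
rewrite integral_cst//= lebesgue_measure_itv/=.
apply: lte_mul_pinfty; rewrite ?ge0_fin_numE//.
by case: ifPn => _; rewrite -?EFinD ltry.
Qed.

Lemma compact_vol_lty n (A : set 'rV[R]_n) : compact A -> (vol A < +oo)%E.
Proof.
move=> cA; have /ex_strict_bound_gt0[M M0 AM] := compact_bounded cA.
apply: le_lt_trans (lebesgue_tuple_cube n M).
apply: le_measure; rewrite ?inE//.
- exact: compact_measurable_row.
- rewrite (_ : mkset _ = @row_of_tuple n @^-1`
      [set v : 'rV[R]_n | forall i, `[-M, M]%classic (v ord0 i)]).
    apply: compact_measurable_row; apply: (@rV_compact R n (fun=> `[-M, M]%classic)) => i.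
    exact: segment_compact.
  by apply/seteqP; split => t /= tM i; have := tM i; rewrite !mxE/= in_itv/= ler_norml.
move=> t At i /=; apply/ltW; apply: le_lt_trans (AM _ At).
have := @mx_normrE R 1 n (row_of_tuple t); rewrite -[mx_norm _]/(`|row_of_tuple t|) => ->.
apply: (le_trans _ (@le_bigmax _ _ _ 0
  (fun ij => `|row_of_tuple t ij.1 ij.2|) (ord0, i))) => /=.
by rewrite mxE.
Qed.

Lemma fin_num_vol n (A : set 'rV[R]_n) : compact A -> vol A \is a fin_num.
Proof. by move=> cA; rewrite ge0_fin_numE ?measure_ge0// compact_vol_lty. Qed.

Lemma le_vol n (A B : set 'rV[R]_n) : compact A -> compact B -> A `<=` B ->
  (vol A <= vol B)%E.
Proof.
move=> cA cB AB; apply: le_measure; rewrite ?inE//; try exact: compact_measurable_row.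
by move=> t; exact: AB.
Qed.

Lemma vol_affine n c (v : 'rV[R]_n) (A : set 'rV[R]_n) : 0 < c -> compact A ->
  vol [set c *: x + v | x in A] = ((c ^+ n)%:E * vol A)%E.
Proof.
move=> c0 cA.
have cA' : compact [set c *: x + v | x in A].
  apply: continuous_compact => //; apply: continuous_subspaceT => x.
  exact: (cvgD (@scaler_continuous R 'rV[R]_n c x) (cvg_cst v)).
have mA' := compact_measurable_row cA'.
rewrite [LHS](_ : _ = mu n (@row_of_tuple n @^-1` [set c *: x + v | x in A]))//.
rewrite -(lebesgue_tuple_affine (tuple_of_row v) c0 mA'); congr (_ * mu n _)%E.
have e t : row_of_tuple (tuple_affine c (tuple_of_row v) t) = c *: row_of_tuple t + v.
  by apply/rowP => i; rewrite !mxE !tnth_mktuple.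
apply/seteqP; split => t /=.
  rewrite e => -[x Ax /addIr /(scalerI (lt0r_neq0 c0)) xE].
  by rewrite /= -/(row_of_tuple t) -xE.
by move=> At; exists (row_of_tuple t) => //; rewrite e.
Qed.

End Volume.

(** * Volume of a sum with a zonotope *)

Section Polynomials.
Context (R : realType).
Implicit Types (p q : {poly R}) (n : nat).

(** If p = q X + c decays like 1 / t, so does q, because t q(t) = p(t) - c stays bounded. By
    induction q = 0, and a constant that decays is 0. *)
Lemma poly_decay0 p (C : R) : (forall t, 1 <= t -> `|p.[t]| <= C / t) -> p = 0.
Proof.
elim/poly_ind: p C => // q c IH C H.
have q0 : q = 0.
  apply: (IH (`|c| + C)) => t t1; have t0 : 0 < t by exact: lt_le_trans t1.
  have := H t t1; rewrite hornerMXaddC => H1.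
  rewrite ler_pdivlMr// -{2}(gtr0_norm t0) -normrM.
  rewrite (_ : q.[t] * t = (q.[t] * t + c) - c); last by ring.
  apply: le_trans (ler_normB _ _) _; rewrite addrC lerD2l (le_trans H1)//.
  have C0 : 0 <= C by have := le_trans (normr_ge0 _) H1; rewrite pmulr_lge0// invr_gt0.
  by rewrite ler_piMr// invf_le1.
rewrite q0 mul0r add0r in H *; have [->//|c0] := eqVneq c 0.
(* At this t the product |c| t is at least |C| + 1, which exceeds C. *)
have := H (Num.max 1 ((`|C| + 1) / `|c|)); rewrite le_max lexx => /(_ isT).
set M := Num.max _ _; have M0 : 0 < M by rewrite lt_max ltr01.
rewrite hornerC ler_pdivlMr// leNgt => /negP[].
apply: (@lt_le_trans _ _ (`|C| + 1)); first by rewrite (le_lt_trans (ler_norm _))// ltrDl.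
by rewrite mulrC -ler_pdivrMr ?normr_gt0// le_max lexx orbT.
Qed.

(** Splitting off the constant coefficient lowers the exponent by one; at exponent 0 the quotient
    decays like 1 / t and vanishes. This turns a growth estimate from homogeneity into a degree
    bound. *)
Lemma size_poly_growth p n (C : R) :
  (forall t, 1 <= t -> `|p.[t]| <= C * t ^+ n) -> (size p <= n.+1)%N.
Proof.
have step q c m C' : (forall t, 1 <= t -> `|(q * 'X + c%:P).[t]| <= C' * t ^+ m) ->
    forall t, 1 <= t -> `|q.[t]| <= (`|c| + C') * t ^+ m / t.
  move=> H t t1; have t0 : 0 < t by exact: lt_le_trans t1.
  have := H t t1; rewrite hornerMXaddC => H1.
  rewrite ler_pdivlMr// -{2}(gtr0_norm t0) -normrM.
  rewrite (_ : q.[t] * t = (q.[t] * t + c) - c); last by ring.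
  apply: le_trans (ler_normB _ _) _; rewrite addrC mulrDl lerD//.
  by rewrite ler_peMr// exprn_ege1.
elim: n p C => [|n IH] p C; elim/poly_ind: p => [|q c _]; rewrite ?size_poly0// => /step H.
  have -> : q = 0.
    by apply: (@poly_decay0 _ (`|c| + C)) => t /H; rewrite expr0 mulr1.
  by rewrite mul0r add0r size_polyC; case: (c != 0).
have sq : (size q <= n.+1)%N.
  apply: (IH _ (`|c| + C)) => t t1; apply: le_trans (H _ t1) _.
  by rewrite exprSr mulrA mulfK// gt_eqF// (lt_le_trans ltr01).
rewrite (leq_trans (size_polyD _ _))// geq_max.
rewrite (leq_trans (size_polyMleq _ _)) ?size_polyX ?addn2//=.
by rewrite (leq_trans (size_polyC_leq1 _)).
Qed.

(** The nodes 0, ..., n are nonnegative, since parallel volumes are only compared with polynomials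
    for t >= 0. The difference of [p] and its interpolant has more roots than its degree allows. *)
Lemma lagrange_interpolation n : exists2 L : 'I_n.+1 -> {poly R},
  forall j, (size (L j) <= n.+1)%N &
  forall p, (size p <= n.+1)%N -> p = \sum_(j < n.+1) p.[j%:R] *: L j.
Proof.
pose L (j : 'I_n.+1) : {poly R} := \prod_(i < n.+1 | i != j)
  ((j%:R - i%:R)^-1 *: ('X - (i%:R)%:P)).
have Ljj j : (L j).[j%:R] = 1.
  rewrite /L horner_prod big1// => i ij.
  rewrite hornerZ hornerXsubC mulVf// subr_eq0 eqr_nat eq_sym.
  by apply: contra ij => /eqP e; apply/eqP/val_inj.
have Lji j i : i != j -> (L j).[i%:R] = 0.
  by move=> ij; rewrite /L horner_prod (bigD1 i)//= hornerZ hornerXsubC subrr mulr0 mul0r.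
have sL j : (size (L j) <= n.+1)%N.
  rewrite /L (leq_trans (size_prod_leq _ _))//.
  rewrite (eq_bigr (fun _ => 2%N)) => [|i ij]; last first.
    rewrite size_scale ?size_XsubC// invr_eq0 subr_eq0 eqr_nat eq_sym.
    by apply: contra ij => /eqP e; apply/eqP/val_inj.
  rewrite sum_nat_const.
  have -> : #|(fun i : 'I_n.+1 => i != j)| = n by rewrite (cardC1 j) card_ord.
  lia.
exists L => // p sp; pose q : {poly R} := p - \sum_(j < n.+1) p.[j%:R] *: L j.
suff q0 : q = 0 by apply/eqP; rewrite -subr_eq0; apply/eqP.
have sq : (size q <= n.+1)%N.
  rewrite (leq_trans (size_polyD _ _))// geq_max sp size_polyN.
  apply: leq_trans (size_sum _ _ _) _; apply/bigmax_leqP => j _.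
  exact: leq_trans (size_scale_leq _ _) (sL j).
apply: (@roots_geq_poly_eq0 R q [seq (nat_of_ord j)%:R | j <- enum 'I_n.+1]).
- apply/allP => _ /mapP[j _ ->]; apply/rootP.
  rewrite hornerD hornerN horner_sum (bigD1 j)//= hornerZ Ljj mulr1 big1 ?addr0 ?subrr//.
  by move=> i ij; rewrite hornerZ Lji ?mulr0// eq_sym.
- rewrite map_inj_uniq ?enum_uniq// => i j /eqP; rewrite eqr_nat => /eqP e.
  exact: val_inj.
- by rewrite size_map size_enum_ord.
Qed.

(** The limit must be the interpolant of [f]: its distance to [f] at t is bounded by the
    approximation errors at t and at the nodes. The error is relative because volumes are sandwiched
    up to a factor. *)
Lemma poly_relative_limit n (f : R -> R) :
  (forall eta : R, 0 < eta -> exists2 p : {poly R}, (size p <= n.+1)%N &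
     forall t, 0 <= t -> `|f t - p.[t]| <= eta * f t) ->
  exists2 p : {poly R}, (size p <= n.+1)%N & forall t, 0 <= t -> f t = p.[t].
Proof.
move=> H; have [L sL LP] := lagrange_interpolation n.
exists (\sum_(j < n.+1) f j%:R *: L j) => [|t t0].
  apply: leq_trans (size_sum _ _ _) _; apply/bigmax_leqP => j _.
  exact: leq_trans (size_scale_leq _ _) (sL j).
(* The hypothesis at eta = 1 bounds [f s] below by an absolute value. *)
have f0 s : 0 <= s -> 0 <= f s.
  move=> s0; have [p _ /(_ s s0)] := H 1 ltr01.
  by rewrite mul1r; exact: le_trans.
pose S := f t + \sum_(j < n.+1) f j%:R * `|(L j).[t]|.
have S0 : 0 <= S by rewrite addr_ge0 ?f0//; apply: sumr_ge0 => j _; rewrite mulr_ge0 ?f0.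
apply/eqP; rewrite -subr_eq0 -normr_le0; apply/ler_addgt0Pr => e e0.
rewrite add0r; pose eta := e / (S + 1).
have S1 : 0 < S + 1 by rewrite ltr_wpDl.
have eta0 : 0 < eta by rewrite divr_gt0.
have [p sp pP] := H _ eta0.
have -> : f t - (\sum_(j < n.+1) f j%:R *: L j).[t] =
    (f t - p.[t]) - \sum_(j < n.+1) (f j%:R - p.[j%:R]) * (L j).[t].
  rewrite {1}(LP p sp) !horner_sum -addrA; congr (_ + _).
  rewrite -opprD -big_split; congr (- _); apply: eq_bigr => j _.
  by rewrite /= !hornerZ; ring.
apply: (@le_trans _ _ (eta * S)); last first.
  by rewrite /eta -mulrA ler_piMr ?(ltW e0)// mulrC ler_pdivrMr// mul1r lerDl.
apply: le_trans (ler_normB _ _) _; rewrite mulrDr lerD ?pP//.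
apply: le_trans (ler_norm_sum _ _ _) _; rewrite mulr_sumr; apply: ler_sum => j _.
by rewrite normrM mulrA ler_wpM2r// pP.
Qed.

End Polynomials.

(** * Minkowski sums, dilates and zonotopes *)

Section MinkowskiAlgebra.
Context (R : realType) (n : nat).
Implicit Types (A B C K : set 'rV[R]_n) (s t : R).

Lemma minkowski_sumC A B : minkowski_sum A B = minkowski_sum B A.
Proof.
by apply/seteqP; split => _ [x Ax [y By <-]]; exists y => //; exists x => //; rewrite addrC.
Qed.

Lemma minkowski_sumA A B C :
  minkowski_sum A (minkowski_sum B C) = minkowski_sum (minkowski_sum A B) C.
Proof.
apply/seteqP; split => [_ [x Ax [_ [y By [z Cz <-]] <-]]|_ [_ [x Ax [y By <-]] [z Cz <-]]].
  by exists (x + y); [exists x => //; exists y|exists z => //; rewrite addrA].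
by exists x => //; exists (y + z); [exists y => //; exists z|rewrite addrA].
Qed.

Lemma minkowski_sum0 A : minkowski_sum A [set 0] = A.
Proof.
apply/seteqP; split => [_ [x Ax [_ -> <-]]|x Ax]; first by rewrite addr0.
by exists x => //; exists 0 => //; rewrite addr0.
Qed.

Lemma minkowski_sumS A A' B B' : A `<=` A' -> B `<=` B' ->
  minkowski_sum A B `<=` minkowski_sum A' B'.
Proof. by move=> AA' BB' _ [x /AA' Ax [y /BB' By <-]]; exists x => //; exists y. Qed.

Lemma dilateD t A B :
  dilate t (minkowski_sum A B) = minkowski_sum (dilate t A) (dilate t B).
Proof.
apply/seteqP; split => [_ [_ [x Ax [y By <-]] <-]|_ [_ [x Ax <-] [_ [y By <-] <-]]].
  by exists (t *: x); [exists x|exists (t *: y); [exists y|rewrite scalerDr]].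
by exists (x + y); [exists x => //; exists y|rewrite scalerDr].
Qed.

Lemma dilate_set0 t : dilate t [set (0 : 'rV[R]_n)] = [set 0].
Proof.
apply/seteqP; split => [_ [_ -> <-]|_ ->]; first by rewrite /= scaler0.
by exists 0 => //; rewrite scaler0.
Qed.

Lemma dilateS t A B : A `<=` B -> dilate t A `<=` dilate t B.
Proof. by move=> AB _ [x /AB Bx <-]; exists x. Qed.

Lemma dilateM s t A : dilate s (dilate t A) = dilate (s * t) A.
Proof.
apply/seteqP; split => [_ [_ [x Ax <-] <-]|_ [x Ax <-]].
  by exists x => //; rewrite scalerA.
by exists (t *: x); [exists x|rewrite scalerA].
Qed.

Lemma dilate1 A : dilate 1 A = A.
Proof.
apply/seteqP; split => [_ [x Ax <-]|x Ax]; first by rewrite scale1r.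
by exists x => //; rewrite scale1r.
Qed.

Definition zonotope (vs : seq 'rV[R]_n) : set 'rV[R]_n :=
  foldr (fun v Z => minkowski_sum (sseg v) Z) [set 0] vs.

Lemma convex_body_set1 (x : 'rV[R]_n) : convex_body [set x].
Proof.
apply/convex_bodyP; split; [by exists x|exact: compact_set1|].
by move=> _ _ c -> -> _; rewrite /= -scalerDl addrC subrK scale1r.
Qed.

Lemma convex_body_zonotope vs : convex_body (zonotope vs).
Proof.
elim: vs => [|v vs IH] /=; first exact: convex_body_set1.
by apply: convex_body_minkowski_sum => //; exact: convex_body_sseg.
Qed.

Lemma vol_dilate t A : 0 < t -> compact A ->
  vol (dilate t A) = ((t ^+ n)%:E * vol A)%E.
Proof.
move=> t0 cA; rewrite -(vol_affine 0 t0 cA); congr vol.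
by apply/seteqP; split => _ [x Ax <-]; exists x => //; rewrite addr0.
Qed.

End MinkowskiAlgebra.

(** * Adding segments to a convex body *)

Section SegmentSum.
Context (R : realType).
Local Notation mR := (measurableTypeR R).
Let leb : {sigma_finite_measure set mR -> \bar R} := @lebesgue_measure R.

(** [F] is an interval [a, b], and adding s [-d, d] lengthens it by s |d| at both ends. The empty
    fibre is a separate case, since thickening leaves it empty. *)
Lemma lebesgue_measure_thicken (F : set R) (d : R) :
  compact F -> (forall x y c, F x -> F y -> 0 <= c <= 1 -> F (c * x + (1 - c) * y)) ->
  (F = set0) \/ (exists l : R,
  forall s, 0 <= s -> leb [set x | exists2 r, `|r| <= 1 & F (x - s * (r * d))] =
    (l + 2 * s * `|d|)%:E).
Proof.
move=> cF vF; have [|/set0P F0] := eqVneq F set0; [by left|right].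
have cid : {within F, continuous (@idfun R)}.
  by apply: continuous_subspaceT => x; exact: cvg_id.
have [b + bmax] := compact_EVT_max F0 cF cid.
have [a + amin] := compact_EVT_min F0 cF cid.
rewrite !inE => Fa Fb.
have ab : a <= b by apply: (amin b); rewrite inE.
have FE x : F x <-> a <= x <= b.
  split => [Fx|/andP[ax xb]].
    by apply/andP; split; [apply: (amin x)|apply: (bmax x)]; rewrite inE.
  have [e|ne] := eqVneq a b.
    by have -> : x = a by apply/eqP; rewrite eq_le ax e xb.
  have ba : 0 < b - a by rewrite subr_gt0 lt_neqAle ne.
  have -> : x = (b - x) / (b - a) * a + (1 - (b - x) / (b - a)) * b.
    by field; rewrite gt_eqF.
  apply: vF => //; rewrite divr_ge0 ?subr_ge0 ?(ltW ba)//= ler_pdivrMr// mul1r.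
  by rewrite lerD2l lerN2.
exists (b - a) => s s0.
have -> : [set x | exists2 r, `|r| <= 1 & F (x - s * (r * d))] =
    `[a - s * `|d|, b + s * `|d|]%classic.
  apply/seteqP; split => x /=; rewrite in_itv/=.
    move=> [r r1 /FE /andP[h1 h2]].
    have : `|s * (r * d)| <= s * `|d|.
      rewrite !normrM (ger0_norm s0) ler_wpM2l// ler_piMl//.
    by rewrite ler_norml => /andP[h3 h4]; apply/andP; split; lra.
  move=> /andP[h1 h2].
  have key e : `|e| <= s * `|d| -> exists2 r, `|r| <= 1 & e = s * (r * d).
    move=> he; have [sd0|sd0] := eqVneq (s * d) 0.
      exists 0; rewrite ?normr0 ?ler01// mul0r mulr0.
      by apply/eqP; rewrite -normr_le0 (le_trans he)// -{1}(ger0_norm s0) -normrM sd0 normr0.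
    exists (e / (s * d)).
      by rewrite normrM normfV ler_pdivrMr ?normr_gt0// mul1r normrM (ger0_norm s0).
    by move: sd0; rewrite mulf_eq0 negb_or => /andP[s_0 d_0]; field; rewrite s_0 d_0.
  have sd : 0 <= s * `|d| by rewrite mulr_ge0.
  (* The point x - e is the point of [a, b] nearest to x. *)
  have [e he Fe] : exists2 e, `|e| <= s * `|d| & a <= x - e <= b.
    have [xa|ax] := ltP x a; first by exists (x - a); [rewrite ler_norml|]; lra.
    have [bx|xb] := ltP b x; first by exists (x - b); [rewrite ler_norml|]; lra.
    by exists 0; rewrite ?normr0//; lra.
  by have [r r1 ee] := key e he; exists r => //; apply/FE; rewrite -ee.
rewrite [leb _]lebesgue_measure_itv/= lte_fin; case: ltP => h.
  by rewrite -EFinD; congr EFin; ring.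
have sd : 0 <= s * `|d| by rewrite mulr_ge0.
congr EFin; lra.
Qed.

Lemma measurable_consp_ysection n (A : set (n.+1.-tuple mR)) : measurable A ->
  measurable_fun setT (fun s : n.-tuple mR => leb [set x | A (consp (x, s))]).
Proof.
move=> /measurable_preimage_consp mA.
have := measurable_fun_ysection leb mA.
congr measurable_fun; apply/funext => x /=; congr (leb _).
by apply/seteqP; split => t; rewrite /ysection/= inE.
Qed.

(* In the direction of [v] every fibre of [K + t [-v, v]] is an interval that
   is longer than the fibre of [K] by an amount linear in [t]. *)
Lemma vol_add_sseg n (K : set 'rV[R]_n.+1) (v : 'rV[R]_n.+1) (t : R) :
  convex_body K -> v ord0 ord0 != 0 -> 0 <= t ->
  (vol (minkowski_sum K (dilate t (sseg v))) + t%:E * vol K =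
   vol K + t%:E * vol (minkowski_sum K (sseg v)))%E.
Proof.
move=> bK v0 t0; set d := v ord0 ord0 in v0 *.
pose Kt s := minkowski_sum K (dilate s (sseg v)).
have bKt s : convex_body (Kt s).
  apply: convex_body_minkowski_sum => //; apply: convex_body_dilate.
  exact: convex_body_sseg.
(* The shear by [w] sends the first basis vector to v / d. *)
pose w : n.-tuple mR := [tuple v ord0 (lift ord0 j) / d | j < n].
pose A s := tuple_shear w @^-1` (@row_of_tuple R n.+1 @^-1` Kt s).
have mA s : measurable (A s).
  have mKt : measurable (@row_of_tuple R n.+1 @^-1` Kt s).
    by apply: compact_measurable_row; have [] := bKt s.
  by rewrite -[X in measurable X]setTI; exact: measurable_tuple_shear.
have volE s : vol (Kt s) = (\int[lebesgue_tuple R n]_u leb [set x | A s (consp (x, u))])%E.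
  rewrite -lebesgue_tupleS_swap// lebesgue_tuple_shear//.
  by apply: compact_measurable_row; have [] := bKt s.
have Kt0 : Kt 0 = K.
  rewrite /Kt -[RHS]minkowski_sum0; congr minkowski_sum.
  apply/seteqP; split => [_ [x _ <-]|_ ->]; first by rewrite scale0r.
  exists (0 *: v); last by rewrite !scale0r.
  by exists 0 => //=; rewrite in_itv/= lerN10 ler01.
have Kt1 : Kt 1 = minkowski_sum K (sseg v) by rewrite /Kt dilate1.
(* Affinity in t is written as an identity between the values at 0, 1 and t without subtraction,
   which suits extended reals and can be integrated fibre by fibre. *)
suff : (vol (Kt t) + t%:E * vol (Kt 0%R) = vol (Kt 0%R) + t%:E * vol (Kt 1%R))%E.
  by rewrite Kt0 Kt1.
rewrite !volE.
have mf s := measurable_consp_ysection (mA s).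
rewrite -!ge0_integralZl_EFin// -!ge0_integralD//;
  try (by move=> u _; rewrite mule_ge0// lee_fin);
  try exact: measurable_funeM.
apply: eq_integral => u _.
pose p x := row_of_tuple (tuple_shear w (consp (x, u))).
have behead_consp y : [tuple of behead (consp (y, u))] = u by exact: val_inj.
(* Moving by y along the first axis before the shear is moving by (y / d) v after it. *)
have pE x y : p x - (y / d) *: v = p (x - y).
  apply/rowP => i; rewrite !mxE /tuple_shear !behead_consp !theadE.
  case: (unliftP ord0 i) => [j|] ->; rewrite /consp ?tnthS ?tnth0 /=; last first.
    by rewrite divfK.
  rewrite /tuple_affine !tnth_mktuple /w (_ : v 0 _ = v ord0 (lift ord0 j))//.
  by field.
pose F := [set x | K (p x)].
have AE s : [set x | A s (consp (x, u))] =
    [set x | exists2 r, `|r| <= 1 & F (x - s * (r * d))].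
  apply/seteqP; split => x /=; rewrite /A/= -/(p x).
    move=> [y Ky [_ [_ [r rI <-] <-] yE]]; exists r; first by rewrite ler_norml.
    by rewrite /F/= -pE -yE mulrA mulfK// scalerA addrK.
  move=> [r r1 Fr]; exists (p (x - s * (r * d))) => //.
  exists (s *: (r *: v)).
    by exists (r *: v) => //; exists r => //=; rewrite in_itv/= -ler_norml.
  by rewrite -pE mulrA mulfK// scalerA subrK.
have pE0 x : p x = p 0 + (x / d) *: v.
  by have := pE x x; rewrite subrr => <-; rewrite subrK.
have cp : continuous p.
  rewrite (_ : p = fun x => p 0 + (x / d) *: v); last by apply/funext => x; exact: pE0.
  move=> x; apply: (@cvgD _ 'rV[R]_n.+1); first exact: cvg_cst.
  apply: (@continuous_comp _ _ _ (fun x : R => x / d) (fun r : R => r *: v)).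
    by apply: (@cvgM R); [exact: cvg_id|exact: cvg_cst].
  exact: (@scalel_continuous R 'rV[R]_n.+1 v).
have cK : compact K by case: bK.
have cF : compact F.
  have /ex_strict_bound_gt0[M M0 KM] := compact_bounded cK.
  apply: (@subclosed_compact _ _ `[-M, M]%classic); last 2 first.
  - exact: segment_compact.
  - move=> x Kx; rewrite /= in_itv/= -ler_norml; apply/ltW; apply: le_lt_trans (KM _ Kx).
    have := @mx_normrE R 1 n.+1 (p x); rewrite -[mx_norm _]/(`|p x|) => ->.
    apply: (le_trans _ (@le_bigmax _ _ _ 0 (fun ij => `|p x ij.1 ij.2|) (ord0, ord0))) => /=.
    by rewrite mxE /tuple_shear /consp tnth0 theadE.
  move/continuous_closedP : cp; apply.
  exact: (compact_closed (@norm_hausdorff R 'rV[R]_n.+1) cK).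
have vF x y c : F x -> F y -> 0 <= c <= 1 -> F (c * x + (1 - c) * y).
  have /convex_bodyP[_ _ vK] := bK.
  rewrite /F/= => Fx Fy c01; have := vK _ _ _ Fx Fy c01; congr K.
  rewrite (pE0 x) (pE0 y) [RHS]pE0 !scalerDr addrACA -scalerDl.
  rewrite [X in X *: p 0](_ : _ = 1) ?scale1r; last by ring.
  by rewrite !scalerA -scalerDl; congr (_ + _ *: _); ring.
have [F0|[l lE]] := lebesgue_measure_thicken d cF vF.
  have e s : leb [set x | A s (consp (x, u))] = 0%E.
    rewrite AE (_ : mkset _ = set0) ?measure0//.
    by apply/seteqP; split => x //= [r _]; rewrite F0.
  by rewrite !e !mule0.
rewrite !AE !lE// -!EFinM -!EFinD; congr EFin; ring.
Qed.

(** Induction on the generators for all bodies at once: if p and q are the polynomials for K and K +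
    [-v, v], affinity in the new segment gives p + t (q - p). The degree is bounded separately, by
    growth. *)
Lemma vol_zonotope_poly n (K : set 'rV[R]_n.+1) (vs : seq 'rV[R]_n.+1) :
  convex_body K -> (forall v, v \in vs -> v ord0 ord0 != 0) ->
  exists p : {poly R}, forall t, 0 <= t ->
    vol (minkowski_sum K (dilate t (zonotope vs))) = (p.[t])%:E.
Proof.
elim: vs K => [|v vs IH] K bK vs0.
  exists (fine (vol K))%:P => t _; rewrite /= dilate_set0 minkowski_sum0 hornerC.
  by rewrite fineK// fin_num_vol//; case: bK.
have vs0' u : u \in vs -> u ord0 ord0 != 0 by move=> uvs; rewrite vs0// inE uvs orbT.
have v0 : v ord0 ord0 != 0 by rewrite vs0// inE eqxx.
have bKv : convex_body (minkowski_sum K (sseg v)).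
  by apply: convex_body_minkowski_sum => //; exact: convex_body_sseg.
have [p pE] := IH K bK vs0'; have [q qE] := IH _ bKv vs0'.
exists (p + 'X * (q - p)) => t t0.
have bKZ : convex_body (minkowski_sum K (dilate t (zonotope vs))).
  apply: convex_body_minkowski_sum => //; apply: convex_body_dilate.
  exact: convex_body_zonotope.
have := vol_add_sseg bKZ v0 t0.
have -> : minkowski_sum (minkowski_sum K (dilate t (zonotope vs))) (sseg v) =
    minkowski_sum (minkowski_sum K (sseg v)) (dilate t (zonotope vs)).
  by rewrite -!minkowski_sumA (minkowski_sumC (sseg v)).
have -> : minkowski_sum (minkowski_sum K (dilate t (zonotope vs))) (dilate t (sseg v)) =
    minkowski_sum K (dilate t (zonotope (v :: vs))).
  by rewrite /= dilateD -!minkowski_sumA (minkowski_sumC (dilate t (sseg v))).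
have : vol (minkowski_sum K (dilate t (zonotope (v :: vs)))) \is a fin_num.
  apply: fin_num_vol; have [] // := convex_body_minkowski_sum bK
    (convex_body_dilate t (convex_body_zonotope (v :: vs))).
rewrite qE// pE//; case: (vol _) => [r| |]// _.
rewrite -!EFinM -!EFinD => -[rE]; congr EFin.
rewrite hornerD hornerM hornerX hornerD hornerN.
by rewrite mulrBr addrA -rE addrK.
Qed.

End SegmentSum.

(** * Zonotopes close to the Euclidean ball *)

Section GaussianExpectation.
Context (R : realType).
Local Notation mR := (measurableTypeR R).
Let leb : {sigma_finite_measure set mR -> \bar R} := @lebesgue_measure R.
Implicit Types (f g : mR -> R) (r a b c : R).

(** Density of the centred normal law of variance 1 / (2 pi); its total mass is 1, and it is the
    Gaussian weight of the Wills integral. *)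
Definition gaussian (x : R) : R := expR (- (pi * x ^+ 2)).

Lemma gaussian_gt0 x : 0 < gaussian x. Proof. exact: expR_gt0. Qed.

Lemma measurable_gaussian : measurable_fun setT (gaussian : mR -> R).
Proof.
by apply: measurableT_comp => //; apply: measurableT_comp => //; apply: measurable_funM.
Qed.

Lemma integral_gaussian_scale r : 0 < r ->
  (\int[leb]_x (expR (- (r * x ^+ 2)))%:E = (Num.sqrt (pi / r))%:E)%E.
Proof.
move=> r0; have sr0 : 0 < Num.sqrt r by rewrite sqrtr_gt0.
have mg : measurable_fun setT (fun x : mR => (gauss_fun x)%:E).
  by apply/measurable_EFinP; exact: measurable_gauss_fun.
have := integral_affine 0 (lt0r_neq0 sr0) mg
  (fun x => gauss_fun_ge0 x : (0 <= (gauss_fun x)%:E)%E).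
rewrite integralT_gauss gtr0_norm// => e.
have -> : (\int[leb]_x (expR (- (r * x ^+ 2)))%:E)%E =
    (\int[leb]_x (gauss_fun (Num.sqrt r * x + 0))%:E)%E.
  by apply: eq_integral => x _; rewrite addr0 /gauss_fun exprMn sqr_sqrtr// ltW.
rewrite sqrtrM ?pi_ge0// sqrtrV ?ltW// EFinM -e muleC muleA -EFinM mulVf ?mul1e//.
exact: lt0r_neq0.
Qed.

Lemma integral_gaussian : (\int[leb]_x (gaussian x)%:E = 1)%E.
Proof.
by rewrite integral_gaussian_scale ?pi_gt0// divff ?gt_eqF ?pi_gt0// sqrtr1.
Qed.

Definition gexp f : \bar R := (\int[leb]_x (f x * gaussian x)%:E)%E.

Lemma measurable_mul_gaussian f : measurable_fun setT f ->
  measurable_fun setT (fun x : mR => (f x * gaussian x)%:E).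
Proof.
by move=> mf; apply/measurable_EFinP; apply: measurable_funM => //; exact: measurable_gaussian.
Qed.

Lemma gexp_ge0 f : (forall x, 0 <= f x) -> (0 <= gexp f)%E.
Proof.
by move=> f0; apply: integral_ge0 => x _; rewrite lee_fin mulr_ge0// ltW// gaussian_gt0.
Qed.

Lemma le_gexp f g : measurable_fun setT f -> measurable_fun setT g ->
  (forall x, 0 <= f x) -> (forall x, f x <= g x) -> (gexp f <= gexp g)%E.
Proof.
move=> mf mg f0 fg; apply: ge0_le_integral => //.
- by move=> x _; rewrite lee_fin mulr_ge0// ltW// gaussian_gt0.
- exact: measurable_mul_gaussian.
- exact: measurable_mul_gaussian.
- by move=> x _; rewrite lee_fin ler_wpM2r// ltW// gaussian_gt0.
Qed.

Lemma gexpD f g : measurable_fun setT f -> measurable_fun setT g ->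
  (forall x, 0 <= f x) -> (forall x, 0 <= g x) ->
  gexp (fun x => f x + g x) = (gexp f + gexp g)%E.
Proof.
move=> mf mg f0 g0; rewrite /gexp -ge0_integralD//.
- by apply: eq_integral => x _; rewrite mulrDl.
- by move=> x _; rewrite lee_fin mulr_ge0// ltW// gaussian_gt0.
- exact: measurable_mul_gaussian.
- by move=> x _; rewrite lee_fin mulr_ge0// ltW// gaussian_gt0.
- exact: measurable_mul_gaussian.
Qed.

Lemma gexpZ c f : 0 <= c -> measurable_fun setT f -> (forall x, 0 <= f x) ->
  gexp (fun x => c * f x) = (c%:E * gexp f)%E.
Proof.
move=> c0 mf f0; rewrite /gexp -ge0_integralZl_EFin//.
- by apply: eq_integral => x _; rewrite -mulrA.
- by move=> x _; rewrite lee_fin mulr_ge0// ltW// gaussian_gt0.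
- exact: measurable_mul_gaussian.
Qed.

Lemma gexp_cst c : 0 <= c -> gexp (fun=> c) = c%:E.
Proof.
move=> c0; have m1 : measurable_fun setT ((fun=> 1) : mR -> R) by exact: measurable_cst.
have := @gexpZ c (fun=> 1) c0 m1 (fun=> ler01).
rewrite /gexp; under eq_integral do rewrite mulr1.
by move=> ->; under eq_integral do rewrite mul1r; rewrite integral_gaussian mule1.
Qed.

(** A crude second moment: x^2 <= exp (x^2) and pi >= 2 bound the integrand by exp (- x^2). *)
Lemma gexp_sqr : (gexp (fun x => x ^+ 2)%R <= (Num.sqrt pi)%:E)%E.
Proof.
rewrite -integralT_gauss; apply: ge0_le_integral => //.
- by move=> x _; rewrite lee_fin mulr_ge0 ?sqr_ge0// ltW// gaussian_gt0.
- by apply: measurable_mul_gaussian; exact: measurable_funM.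
- by apply/measurable_EFinP; exact: measurable_gauss_fun.
move=> x _; rewrite lee_fin /gaussian /gauss_fun.
apply: (@le_trans _ _ (expR (x ^+ 2) * expR (- (pi * x ^+ 2)))).
  rewrite ler_wpM2r ?expR_ge0//; apply: le_trans (expR_ge1Dx _).
  by rewrite lerDr.
rewrite -expRD ler_expR; have := pi_ge2 R; have := sqr_ge0 x; nra.
Qed.

Lemma lipschitz_measurable f L : (forall x y, `|f x - f y| <= L * `|x - y|) ->
  measurable_fun setT f.
Proof.
move=> fL; apply: continuous_measurable_fun => x.
have L1 : 0 < `|L| + 1 by rewrite ltr_wpDl.
apply/cvgrPdist_lt => e e0; near=> y.
apply: le_lt_trans (fL x y) _.
apply: (@le_lt_trans _ _ ((`|L| + 1) * `|x - y|)).
  by rewrite ler_wpM2r// (le_trans (ler_norm L))// lerDl.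
rewrite -ltr_pdivlMl// mulrC.
by near: y; apply: (@cvgr_dist_lt _ R^o) => //; rewrite divr_gt0.
Unshelve. all: by end_near. Qed.

Lemma lipschitz_gexp_fin f L : (forall x, 0 <= f x) ->
  (forall x y, `|f x - f y| <= L * `|x - y|) -> gexp f \is a fin_num.
Proof.
move=> f0 fL; have mf := lipschitz_measurable fL.
have L0 : 0 <= L.
  by have := le_trans (normr_ge0 _) (fL 1 0); rewrite subr0 normr1 mulr1.
rewrite ge0_fin_numE ?gexp_ge0//.
have mx2 : measurable_fun setT (fun x : mR => x ^+ 2) by exact: measurable_funM.
apply: (@le_lt_trans _ _ (gexp (fun x => (f 0 + L) + L * x ^+ 2)%R)).
  apply: le_gexp => //.
    by apply: measurable_funD => //; exact: measurable_funM.
  move=> x; have := fL x 0; rewrite subr0 => /(le_trans (ler_norm _)).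
  rewrite lerBlDr => /le_trans; apply.
  rewrite addrC -addrA lerD2l -[X in _ <= X + _]mulr1 -mulrDr ler_wpM2l//.
  (* Linear growth is dominated through |x| <= 1 + x^2, so the second moment suffices. *)
  have := sqr_ge0 (`|x| - 1); rewrite sqrrB real_normK ?num_real// => h.
  have := sqr_ge0 x; have := normr_ge0 x; nra.
rewrite gexpD//; [|exact: measurable_funM|by move=> x; rewrite addr_ge0
  |by move=> x; rewrite mulr_ge0 ?sqr_ge0].
rewrite gexp_cst ?addr_ge0// gexpZ// ?sqr_ge0//; last by move=> x; exact: sqr_ge0.
rewrite lte_add_pinfty ?ltry// lte_mul_pinfty//.
by apply: le_lt_trans gexp_sqr _; rewrite ltry.
Qed.

End GaussianExpectation.

(** * Sums of independent Gaussian variables *)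

Section GaussianConvolution.
Context (R : realType).
Local Notation mR := (measurableTypeR R).
Let leb : {sigma_finite_measure set mR -> \bar R} := @lebesgue_measure R.
Implicit Types (f : mR -> R) (r a b c : R).

Lemma gexp_scale f a : a != 0 -> measurable_fun setT f -> (forall x, 0 <= f x) ->
  (gexp (fun x => f (a * x)%R) = `|a|^-1%:E *
     \int[leb]_z (f z * expR (- (pi * (z / a) ^+ 2)))%:E)%E.
Proof.
move=> a0 mf f0.
have mk : measurable_fun setT (fun z : mR => (f z * expR (- (pi * (z / a) ^+ 2)))%:E).
  apply/measurable_EFinP; apply: measurable_funM => //.
  apply: measurableT_comp => //; apply: measurableT_comp => //.
  apply: measurable_funM => //; apply: measurableT_comp (exprn_measurable _) _.
  exact: measurable_funM.
rewrite -(integral_affine 0 a0 mk); last by move=> z; rewrite lee_fin mulr_ge0 ?expR_ge0.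
rewrite muleA -EFinM mulVf ?normr_eq0// mul1e; apply: eq_integral => x _.
by rewrite addr0 /gaussian; congr (_ * expR (- (pi * _ ^+ 2)))%:E; field.
Qed.

(* [r X + a Y] has the law of [sqrt (r ^ 2 + a ^ 2) X] for independent standard
   Gaussian [X], [Y]: substitute [z = r x + a y] and complete the square. *)
Lemma gaussian_convolution f r a : measurable_fun setT f -> (forall x, 0 <= f x) ->
  (\int[leb]_y (gexp (fun x => f (r * x + a * y)%R) * (gaussian y)%:E) =
   gexp (fun x => f (Num.sqrt (r ^+ 2 + a ^+ 2) * x)%R))%E.
Proof.
move=> mf f0.
have gg0 x : 0 <= gaussian x :> R by rewrite ltW// gaussian_gt0.
(* For r = 0 the substitution in the inner integral degenerates, but the inner expectation is that
   of a constant. *)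
have [->|r0] := eqVneq r 0.
  rewrite expr0n add0r sqrtr_sqr.
  under eq_integral => y _.
    rewrite (_ : (fun x => f (0 * x + a * y)) = fun=> f (a * y)); last first.
      by apply/funext => x; rewrite mul0r add0r.
    rewrite gexp_cst// -EFinM; over.
  rewrite -[LHS]/(gexp (fun y => f (a * y))).
  have [->|a0] := eqVneq a 0; first by rewrite normr0.
  rewrite !gexp_scale ?normr_eq0// normr_id; congr (_ * _)%E.
  by apply: eq_integral => z _; rewrite !exprMn !exprVn real_normK ?num_real.
set s := Num.sqrt _.
have s2 : s ^+ 2 = r ^+ 2 + a ^+ 2 by rewrite sqr_sqrtr// addr_ge0 ?sqr_ge0.
have r2 : 0 < r ^+ 2 by rewrite exprn_even_gt0.
have s0 : 0 < s by rewrite sqrtr_gt0 ltr_wpDr ?sqr_ge0.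
(* Up to the factor 1 / |r|, the joint density of y and z = r x + a y. *)
pose k (y z : R) : R := expR (- (pi * ((z - a * y) / r) ^+ 2)) * gaussian y.
have k0 y z : 0 <= k y z by rewrite mulr_ge0 ?expR_ge0.
have mk : measurable_fun setT (fun yz : mR * mR => k yz.1 yz.2).
  apply: measurable_funM; last by apply: measurableT_comp => //; exact: measurable_gaussian.
  apply: measurableT_comp => //; apply: measurableT_comp => //.
  apply: measurable_funM => //; apply: measurableT_comp (exprn_measurable _) _.
  apply: measurable_funM => //; apply: measurable_funB => //.
  exact: measurable_funM.
transitivity (\int[leb]_y \int[leb]_z (`|r|^-1 * (f z * k y z))%:E)%E.
  apply: eq_integral => y _.
  have mfy : measurable_fun setT (fun x : mR => f (x + a * y)).
    by apply: measurableT_comp => //; exact: measurable_funD.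
  rewrite (@gexp_scale (fun x => f (x + a * y)))//.
  have mh : measurable_fun setT
      (fun z : mR => (f (z + a * y) * expR (- (pi * (z / r) ^+ 2)))%:E).
    apply/measurable_EFinP; apply: measurable_funM => //.
    apply: measurableT_comp => //; apply: measurableT_comp => //.
    apply: measurable_funM => //; apply: measurableT_comp (exprn_measurable _) _.
    exact: measurable_funM.
  rewrite -(integral_affine (- (a * y)) (oner_neq0 R) mh); last first.
    by move=> z; rewrite lee_fin mulr_ge0 ?expR_ge0.
  rewrite normr1 mul1e -muleA -ge0_integralZr//=; last 3 first.
  - by apply: (measurableT_comp mh) => //; exact: measurable_affine.
  - by move=> z _; rewrite lee_fin mulr_ge0 ?expR_ge0.
  - by rewrite lee_fin.
  rewrite -ge0_integralZl_EFin//.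
  - by apply: eq_integral => z _; rewrite -!EFinM mul1r subrK /k !mulrA.
  - by move=> z _; rewrite mule_ge0// lee_fin ?mulr_ge0 ?expR_ge0.
  - apply: emeasurable_funM => //.
    by apply: (measurableT_comp mh) => //; exact: measurable_affine.
rewrite (fubini_tonelli
  (fun yz : mR * mR => (`|r|^-1 * (f yz.2 * k yz.1 yz.2))%:E))/=; last 2 first.
- apply/measurable_EFinP; apply: measurable_funM => //; apply: measurable_funM => //.
  exact: measurableT_comp.
- by move=> yz; rewrite lee_fin !mulr_ge0// invr_ge0.
rewrite gexp_scale ?gt_eqF// (gtr0_norm s0) -ge0_integralZl_EFin//; last 3 first.
- by move=> z _; rewrite lee_fin mulr_ge0 ?expR_ge0.
- apply/measurable_EFinP; apply: measurable_funM => //.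
  apply: measurableT_comp => //; apply: measurableT_comp => //.
  apply: measurable_funM => //; apply: measurableT_comp (exprn_measurable _) _.
  exact: measurable_funM.
- by rewrite invr_ge0 ltW.
apply: eq_integral => z _.
have mg : measurable_fun setT (fun y : mR => (gaussian y)%:E : \bar R).
  by apply/measurable_EFinP; exact: measurable_gaussian.
have sr0 : s / r != 0 by rewrite mulf_neq0 ?invr_eq0 ?r0 ?(lt0r_neq0 s0).
(* Completing the square in y, with s^2 = r^2 + a^2, leaves a Gaussian in z / s times one in an
   affine function of y of slope s / r; the latter integrates to |r| / s. *)
have kE y : k y z =
    expR (- (pi * (z / s) ^+ 2)) * gaussian ((s / r) * y + (- (a * z / (r * s)))).
  have sn0 : s != 0 by rewrite gt_eqF.
  have E1 : (z / s) ^+ 2 + (s / r * y + (- (a * z / (r * s)))) ^+ 2 =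
      (r ^+ 2 * z ^+ 2 + (s ^+ 2 * y - a * z) ^+ 2) / (s ^+ 2 * r ^+ 2).
    by field; rewrite r0 sn0.
  have E2 : ((z - a * y) / r) ^+ 2 + y ^+ 2 =
      (z / s) ^+ 2 + (s / r * y + (- (a * z / (r * s)))) ^+ 2.
    by rewrite E1 s2; field; rewrite r0 -s2 expf_neq0.
  by rewrite /k /gaussian -!expRD -!opprD -!mulrDr E2.
under eq_integral => y _.
  rewrite (_ : (_ * _)%:E = (`|r|^-1 * (f z * expR (- (pi * (z / s) ^+ 2))))%:E *
    (gaussian ((s / r) * y + (- (a * z / (r * s)))))%:E)%E; last by rewrite kE -EFinM !mulrA.
  over.
rewrite ge0_integralZl_EFin//; last 3 first.
- by move=> y _; rewrite lee_fin.
- by apply: (measurableT_comp mg); exact: measurable_affine.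
- by rewrite !mulr_ge0 ?expR_ge0// invr_ge0.
have := integral_affine (- (a * z / (r * s))) sr0 mg
  (fun x => gg0 x : (0 <= (gaussian x)%:E)%E).
rewrite integral_gaussian => e1.
have -> : (\int[leb]_y (gaussian (s / r * y - a * z / (r * s)))%:E)%E = (`|s / r|^-1%:E)%E.
  apply/eqP; rewrite eq_sym -[X in X == _]mule1 -e1 muleA -EFinM mulVf ?normr_eq0// mul1e.
  by [].
rewrite -!EFinM; congr EFin; rewrite normrM normfV (gtr0_norm s0).
by field; rewrite normr_eq0 r0 gt_eqF.
Qed.

End GaussianConvolution.

(** * Discretization of the Gaussian on the line *)

Section GaussianDiscretization.
Context (R : realType).
Local Notation mR := (measurableTypeR R).
Let leb : {sigma_finite_measure set mR -> \bar R} := @lebesgue_measure R.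
Implicit Types (f : mR -> R) (r a b c : R).

Lemma gexp_sum M (F : 'I_M -> mR -> R) : (forall i, measurable_fun setT (F i)) ->
  (forall i x, 0 <= F i x) ->
  gexp (fun x => \sum_(i < M) F i x) = (\sum_(i < M) gexp (F i))%E.
Proof.
move=> mF F0; rewrite /gexp -ge0_integral_sum//.
- by apply: eq_integral => x _; rewrite sumEFin mulr_suml.
- by move=> i; exact: measurable_mul_gaussian.
- by move=> i x _; rewrite lee_fin mulr_ge0// ltW// gaussian_gt0.
Qed.

Section Grid.
Variable N : nat.
Hypothesis N0 : (0 < N)%N.

(* Index of the cell of width [1/N] of [[-N, N[] that contains [x]; the points
   outside are sent to the first cell on the right of the origin. *)
Definition grid_index (x : R) : nat :=
  if `|x| < N%:R then Num.truncn (N%:R * x + (N ^ 2)%:R) else (N ^ 2)%N.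

(** Midpoint of the i-th cell. The midpoints are odd multiples of 1 / (2 N), hence never 0. *)
Definition grid_point (i : nat) : R := (i%:R + 2^-1 - (N ^ 2)%:R) / N%:R.

Let Nr0 : 0 < N%:R :> R. Proof. by rewrite ltr0n. Qed.

Let shift_ge0 (x : R) : `|x| < N%:R -> 0 <= N%:R * x + (N ^ 2)%:R.
Proof. by rewrite ltr_norml natrX => /andP[h1 h2]; have := Nr0; nra. Qed.

Lemma grid_index_lt x : (grid_index x < 2 * N ^ 2)%N.
Proof.
rewrite /grid_index; case: ifPn => [xN|_]; last by rewrite ltn_Pmull// expn_gt0 N0.
rewrite -(ltr_nat R); apply: (@le_lt_trans _ _ (N%:R * x + (N ^ 2)%:R)).
  by have /truncn_itv/andP[] := shift_ge0 xN.
move: xN; rewrite ltr_norml natrM !natrX => /andP[h1 h2]; have := Nr0; nra.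
Qed.

Lemma grid_point_neq0 i : grid_point i != 0.
Proof.
apply: mulf_neq0; last by rewrite invr_eq0 gt_eqF.
apply/negP => /eqP e.
have : (2 * i + 1)%:R = (2 * N ^ 2)%:R :> R.
  rewrite natrD (natrM _ 2 i) (natrM _ 2 (N ^ 2)%N). lra.
move=> /eqP; rewrite eqr_nat => /eqP; lia.
Qed.

(** Inside the grid the distance is at most half a cell. Outside, |x| >= N gives |x| <= x^2 / N. One
    bound covers both and is integrable against the Gaussian. *)
Lemma grid_point_dist x :
  `|x - grid_point (grid_index x)| <= N%:R^-1 * (1 + x ^+ 2).
Proof.
rewrite /grid_index; case: ifPn => [xN|].
  have /truncn_itv/andP[] := shift_ge0 xN.
  set j := Num.truncn _; rewrite -natr1 => j1 j2.
  rewrite (_ : x - _ = N%:R^-1 * (N%:R * x + (N ^ 2)%:R - j%:R - 2^-1)); last first.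
    by rewrite /grid_point; field; rewrite gt_eqF.
  rewrite normrM gtr0_norm ?invr_gt0// ler_wpM2l ?invr_ge0 ?(ltW Nr0)//.
    apply: (@le_trans _ _ 1); last by rewrite lerDl sqr_ge0.
  by rewrite ler_norml; apply/andP; split; lra.
rewrite -leNgt => Nx; rewrite /grid_point addrAC subrr add0r.
apply: le_trans (ler_normB _ _) _; rewrite mulrDr mulr1 addrC lerD//.
  by rewrite gtr0_norm ?divr_gt0 ?invr_gt0// ler_piMl ?invr_ge0 ?(ltW Nr0)// invf_le1 ?ler1n.
rewrite -real_normK ?num_real// mulrC ler_pdivlMr// expr2 ler_wpM2l//.
Qed.

Lemma measurable_grid_cell i : measurable [set x : mR | grid_index x = i].
Proof.
have -> : [set x : mR | grid_index x = i] =
    (`](- N%:R), N%:R[ `&` `[(i%:R - (N ^ 2)%:R) / N%:R, (i.+1%:R - (N ^ 2)%:R) / N%:R[) `|`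
    (~` `](- N%:R), N%:R[ `&` (if i == (N ^ 2)%N then setT else set0)) :> set mR.
  have inI (x : R) : (x \in `](- N%:R), N%:R[) = (`|x| < N%:R).
    by rewrite in_itv/= ltr_norml.
  have inC (x : R) : (x \in `[(i%:R - (N ^ 2)%:R) / N%:R, (i.+1%:R - (N ^ 2)%:R) / N%:R[) =
      (i%:R <= N%:R * x + (N ^ 2)%:R < i.+1%:R).
    by rewrite in_itv/= ler_pdivrMr// ltr_pdivlMr// mulrC lerBlDr ltrBrDr.
  apply/seteqP; split => x /=; rewrite inI inC /grid_index.
    case: ifPn => [xN iE|xN <-]; [left|right].
      by split => //; rewrite -iE; exact/truncn_itv/shift_ge0.
    by split; [exact/negP|rewrite eqxx].
  case=> [[xN h]|[/negP/negbTE ->]]; last by case: eqP.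
  by rewrite xN; apply/eqP; rewrite truncn_eq ?shift_ge0.
apply: measurableU; apply: measurableI => //; first exact: measurableC.
by case: ifPn.
Qed.

End Grid.

(** The weights are the Gaussian masses of the cells, so the error is at most L times the mean
    distance to the grid point. One grid serves all Lipschitz functions, hence later all directions
    u. *)
Lemma gaussian_discretization eps : 0 < eps ->
  exists M (w a : 'I_M -> R), [/\ forall i, 0 <= w i, \sum_i w i = 1,
    forall i, a i != 0 & forall f L, (forall x, 0 <= f x) ->
    (forall x y, `|f x - f y| <= L * `|x - y|) ->
    `|\sum_i w i * f (a i) - fine (gexp f)| <= L * eps].
Proof.
move=> eps0.
(* The mean of (1 + x^2) / N is at most (1 + sqrt pi) / N, which this N brings below eps. *)
pose N := (Num.truncn ((1 + Num.sqrt pi) / eps)).+1.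
have N0 : (0 < N)%N by [].
have Nr0 : 0 < N%:R :> R by rewrite ltr0n.
have Neps : N%:R^-1 * (1 + Num.sqrt pi) <= eps.
  by rewrite mulrC ler_pdivrMr// mulrC -ler_pdivrMr// ltW// truncnS_gt.
pose M := (2 * N ^ 2)%N; pose k := grid_index N; pose a (i : 'I_M) := grid_point N i.
pose cell (i : 'I_M) : mR -> R := \1_[set x : mR | k x = i].
have mcell i : measurable_fun setT (cell i).
  by apply: measurable_indic; exact: measurable_grid_cell.
have cell0 i x : 0 <= cell i x by rewrite /cell indicE.
have cellE (c : 'I_M -> R) x : \sum_i c i * cell i x = c (Ordinal (grid_index_lt N0 x)).
  rewrite (bigD1 (Ordinal (grid_index_lt N0 x)))//= big1 => [|i ik].
    by rewrite /cell indicE mem_set// mulr1 addr0.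
  rewrite /cell indicE memNset ?mulr0//= => e; move/negP: ik; apply; apply/eqP.
  by apply: val_inj; rewrite /= -e.
have cell_fin i : gexp (cell i) \is a fin_num.
  rewrite ge0_fin_numE ?gexp_ge0//; apply: (@le_lt_trans _ _ (gexp (fun=> 1))).
    by apply: le_gexp => // x; rewrite /cell indicE; case: (_ \in _).
  by rewrite gexp_cst ?ltry.
pose w i := fine (gexp (cell i)).
have wE (c : 'I_M -> R) : (forall i, 0 <= c i) ->
    gexp (fun x => c (Ordinal (grid_index_lt N0 x))) = (\sum_i w i * c i)%:E.
  move=> c0; rewrite (_ : (fun x => _) = fun x => \sum_i c i * cell i x); last first.
    by apply/funext => x; rewrite cellE.
  rewrite gexp_sum => [|i|i x]; [|exact: measurable_funM|by rewrite mulr_ge0].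
  rewrite -sumEFin; apply: eq_bigr => i _.
  by rewrite gexpZ// mulrC EFinM fineK.
exists M, w, a; split => [i|||].
- by rewrite fine_ge0// gexp_ge0.
- have := wE (fun=> 1) (fun=> ler01); rewrite gexp_cst// => -[->].
  by apply: eq_bigr => i _; rewrite mulr1.
- by move=> i; exact: grid_point_neq0.
move=> f L f0 fL.
have L0 : 0 <= L.
  by have := le_trans (normr_ge0 _) (fL 1 0); rewrite subr0 normr1 mulr1.
have mf := lipschitz_measurable fL; have ff := lipschitz_gexp_fin f0 fL.
pose g x := f (a (Ordinal (grid_index_lt N0 x))).
have gE : gexp g = (\sum_i w i * f (a i))%:E by exact: (wE (fun i => f (a i)) (fun i => f0 _)).
have mg : measurable_fun setT g.
  rewrite (_ : g = fun x => \sum_i f (a i) * cell i x); last first.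
    by apply/funext => x; rewrite (cellE (fun i => f (a i))).
  by apply: measurable_sum => i; apply: measurable_funM => //; exact: mcell.
pose h x : R := L * (N%:R^-1 * (1 + x ^+ 2)).
have h0 x : 0 <= h x by rewrite !mulr_ge0 ?invr_ge0 ?addr_ge0 ?sqr_ge0.
have mh : measurable_fun setT (h : mR -> R).
  apply: measurable_funM => //; apply: measurable_funM => //.
  by apply: measurable_funD => //; exact: measurable_funM.
have hE : (gexp h <= (L * eps)%:E)%E.
  rewrite gexpZ//; last 2 first.
  - apply: measurable_funM => //.
    by apply: measurable_funD => //; exact: measurable_funM.
  - by move=> x; rewrite mulr_ge0 ?invr_ge0 ?addr_ge0 ?sqr_ge0.
  rewrite EFinM; apply: lee_wpmul2l; first by rewrite lee_fin.
  rewrite gexpZ ?invr_ge0//; last 2 first.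
  - by apply: measurable_funD => //; exact: measurable_funM.
  - by move=> x; rewrite addr_ge0 ?sqr_ge0.
  rewrite gexpD//; last by move=> x; rewrite sqr_ge0.
  rewrite gexp_cst//; apply: (@le_trans _ _ ((N%:R^-1)%:E * (1 + (Num.sqrt pi)%:E))%E).
    by apply: lee_wpmul2l; rewrite ?lee_fin ?invr_ge0// leeD2l// gexp_sqr.
  by rewrite -EFinD -EFinM lee_fin.
have fg x : `|f x - g x| <= h x.
  apply: le_trans (fL _ _) _; rewrite ler_wpM2l//; exact: grid_point_dist.
have f_le : (gexp f <= gexp g + (L * eps)%:E)%E.
  apply: le_trans (leeD2l _ hE); rewrite -gexpD//.
    apply: le_gexp => //; first exact: measurable_funD.
    by move=> x; rewrite -lerBlDl; apply: le_trans (ler_norm _) (fg x).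
  by move=> x; exact: f0.
have g_le : (gexp g <= gexp f + (L * eps)%:E)%E.
  apply: le_trans (leeD2l _ hE); rewrite -gexpD//.
  apply: le_gexp => //; [exact: measurable_funD|by move=> x; exact: f0|].
  by move=> x; rewrite -lerBlDl; apply: le_trans (ler_norm _) _; rewrite distrC.
move: f_le g_le; rewrite gE -(fineK ff) -!EFinD !lee_fin => f_le g_le.
by rewrite ler_distl lerBlDr f_le g_le.
Qed.

End GaussianDiscretization.

(** * Absolute means of linear forms in a Gaussian vector *)

Section GaussianFamilies.
Context (R : realType).
Local Notation mR := (measurableTypeR R).
Let leb : {sigma_finite_measure set mR -> \bar R} := @lebesgue_measure R.
Implicit Types (r a b c : R).

(** E |r X + c| for Gaussian X. The offset c carries the coordinates already fixed in the induction
    on the dimension. *)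
Definition abs_mean r c : R := fine (gexp (fun t : mR => `|r * t + c|)).

Lemma lipschitz_abs_affine r c (x y : R) :
  `| `|r * x + c| - `|r * y + c| | <= `|r| * `|x - y|.
Proof.
apply: le_trans (ler_dist_dist _ _) _.
by rewrite -normrM mulrBr opprD addrACA subrr addr0.
Qed.

Lemma measurable_abs_affine r c : measurable_fun setT (fun t : mR => `|r * t + c|).
Proof. exact: lipschitz_measurable (lipschitz_abs_affine r c). Qed.

Lemma abs_meanE r c : gexp (fun t : mR => `|r * t + c|) = (abs_mean r c)%:E.
Proof. by rewrite fineK// (@lipschitz_gexp_fin _ _ `|r|)//; exact: lipschitz_abs_affine. Qed.

Lemma abs_mean_ge0 r c : 0 <= abs_mean r c.
Proof. by rewrite fine_ge0// gexp_ge0. Qed.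

Lemma abs_mean_le r c c' : abs_mean r c <= abs_mean r c' + `|c - c'|.
Proof.
rewrite -lee_fin EFinD -!abs_meanE -(gexp_cst (normr_ge0 (c - c'))).
have m := measurable_abs_affine r.
rewrite -gexpD//.
apply: le_gexp => //.
  by apply: measurable_funD.
move=> x; rewrite (_ : r * x + c = (r * x + c') + (c - c')); last by ring.
exact: ler_normD.
Qed.

Lemma abs_mean_lip r c c' : `|abs_mean r c - abs_mean r c'| <= `|c - c'|.
Proof.
rewrite ler_distl lerBlDr abs_mean_le andbT -lerBlDr.
by rewrite lerBlDr distrC abs_mean_le.
Qed.

Lemma abs_mean0 c : abs_mean 0 c = `|c|.
Proof.
rewrite /abs_mean (_ : (fun t => _) = fun=> `|c|) ?gexp_cst//.
by apply/funext => t; rewrite mul0r add0r.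
Qed.

(** One further independent coordinate with coefficient a replaces r by sqrt (r^2 + a^2), as the
    Euclidean norm does. *)
Lemma abs_mean_convolution r a c :
  gexp (fun y : mR => abs_mean r (a * y + c)) =
  (abs_mean (Num.sqrt (r ^+ 2 + a ^+ 2)) c)%:E.
Proof.
have mf : measurable_fun setT (fun x : mR => `|x + c|).
  by have := measurable_abs_affine 1 c; congr measurable_fun; apply/funext => x; rewrite mul1r.
rewrite -abs_meanE -(gaussian_convolution r a mf)// /gexp.
apply: eq_integral => y _; rewrite EFinM -abs_meanE; congr (gexp _ * _)%E.
by apply/funext => x; rewrite addrA.
Qed.

Lemma abs_mean_scale r : 0 <= r -> abs_mean r 0 = r * abs_mean 1 0.
Proof.
move=> r0; apply: EFin_inj; rewrite EFinM -!abs_meanE -gexpZ//; last first.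
  exact: measurable_abs_affine.
congr gexp; apply/funext => t.
by rewrite mul1r !addr0 normrM (ger0_norm r0).
Qed.

(** This is the factor between E |<u, X>| and |u|, by which the zonotope will be normalized. *)
Lemma abs_mean1_gt0 : 0 < abs_mean 1 0.
Proof.
rewrite -lte_fin -abs_meanE.
apply: (@lt_le_trans _ _ (\int[leb]_(x in `[1%R, 2%R]) (gaussian 2)%:E)%E).
  rewrite integral_cst//= lebesgue_measure_itv/= lte_fin ltr1n.
  by rewrite -EFinD -EFinM lte_fin mulr_gt0 ?gaussian_gt0// subr_gt0 ltr1n.
rewrite integral_mkcond; apply: ge0_le_integral => //.
- by move=> x _; apply: erestrict_ge0 => y _; rewrite lee_fin ltW// gaussian_gt0.
- by apply/(measurable_restrictT _ _).1 => //; exact: measurable_cst.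
- by apply: measurable_mul_gaussian; exact: measurable_abs_affine.
move=> x _; rewrite patchE; case: ifPn => [|_]; last first.
  by rewrite lee_fin mulr_ge0// ltW// gaussian_gt0.
rewrite inE/= in_itv/= => /andP[x1 x2]; rewrite lee_fin mul1r addr0.
have x0 : 0 <= x by exact: le_trans x1.
apply: (@le_trans _ _ (1 * gaussian x)).
  rewrite mul1r /gaussian ler_expR lerN2 ler_pM2l ?pi_gt0//.
  by rewrite ler_pXn2r// ?nnegrE.
by rewrite ler_wpM2r ?(ltW (gaussian_gt0 _))// ger0_norm.
Qed.

Definition cons_row n a (x : 'rV[R]_n) : 'rV[R]_n.+1 :=
  \row_j if unlift ord0 j is Some k then x ord0 k else a.

Lemma dot_cons_row n (u : 'rV[R]_n.+1) a (x : 'rV[R]_n) :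
  dot u (cons_row a x) =
  u ord0 ord0 * a + dot (\row_j u ord0 (lift ord0 j)) x.
Proof.
rewrite /dot big_ord_recl mxE unlift_none; congr (_ + _).
by apply: eq_bigr => j _; rewrite !mxE liftK.
Qed.

(* Each family is a discretization of the standard Gaussian vector; since the
   law of [<u, X> + c] depends only on [|u|], so do the absolute means. *)
Lemma gaussian_family n eps : 0 < eps -> exists fam : seq (R * 'rV[R]_n),
  [/\ \sum_(wv <- fam) wv.1 = 1,
    forall wv, wv \in fam -> 0 <= wv.1 /\ forall i, wv.2 ord0 i != 0 &
    forall u c, `|\sum_(wv <- fam) wv.1 * `|dot u wv.2 + c| - abs_mean (enorm u) c|
      <= eps * \sum_i `|u ord0 i|].
Proof.
move=> eps0; elim: n => [|n [fam [fam1 fam_pos famP]]].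
  exists [:: (1, 0)]; split=> [|wv|u c].
  - by rewrite big_seq1.
  - by rewrite inE => /eqP -> /=; split => // -[].
  rewrite big_seq1 big_ord0 mulr0 /enorm /sqn /dot !big_ord0 sqrtr0 abs_mean0.
  by rewrite add0r mul1r subrr normr0.
have [M [w [a [w0 w1 a0 aP]]]] := gaussian_discretization eps0.
pose fam' := [seq (w i * wv.1, cons_row (a i) wv.2) | i <- enum 'I_M, wv <- fam].
have sumE (F : R * 'rV[R]_n.+1 -> R) : \sum_(wv <- fam') F wv =
    \sum_i \sum_(wv <- fam) F (w i * wv.1, cons_row (a i) wv.2).
  by rewrite big_allpairs_dep big_enum.
exists fam'; split => [|wv|u c].
- by rewrite sumE; under eq_bigr do rewrite -mulr_sumr fam1 mulr1.
- move=> /allpairsP[[i x] [_ xfam ->]] /=; have [x0 xn0] := fam_pos _ xfam.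
  by split => [|j]; [exact: mulr_ge0|rewrite mxE; case: unlift].
rewrite sumE; set u' := \row_j u ord0 (lift ord0 j).
(* The exact mean over the remaining coordinates once the first one equals y. It is |u_0|-Lipschitz,
   so discretizing the first coordinate costs eps |u_0|. *)
set f := fun y => abs_mean (enorm u') (u ord0 ord0 * y + c).
have f0 x : 0 <= f x by exact: abs_mean_ge0.
have fL x y : `|f x - f y| <= `|u ord0 ord0| * `|x - y|.
  apply: le_trans (abs_mean_lip _ _ _) _.
  by rewrite -normrM mulrBr opprD addrACA subrr addr0.
have := aP f _ f0 fL; rewrite abs_mean_convolution /=.
have -> : Num.sqrt (enorm u' ^+ 2 + u ord0 ord0 ^+ 2) = enorm u.
  rewrite enorm_sqr addrC /enorm /sqn [in RHS]big_ord_recl; congr (Num.sqrt (_ + _)).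
  by apply: eq_bigr => j _; rewrite mxE.
move=> e1; rewrite big_ord_recl mulrDr (mulrC eps).
set S := \sum_i _; set T := abs_mean _ _; set S' := \sum_i _ in e1.
(* S' discretizes only the first coordinate: S - S' is an average of errors from the induction
   hypothesis, S' - T is the new error. *)
rewrite (_ : S - T = (S - S') + (S' - T)); last by ring.
apply: le_trans (ler_normD _ _) _; rewrite addrC lerD//.
rewrite /S /S' -sumrB; apply: le_trans (ler_norm_sum _ _ _) _.
rewrite [leRHS](_ : _ = \sum_i w i * (eps * \sum_j `|u' ord0 j|)); last first.
  by rewrite -mulr_suml w1 mul1r; congr (_ * _); apply: eq_bigr => j _; rewrite mxE.
apply: ler_sum => i _.
under eq_bigr do rewrite /= dot_cons_row -mulrA.
rewrite -mulr_sumr -mulrBr normrM (ger0_norm (w0 i)) ler_wpM2l//.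
have := famP u' (u ord0 ord0 * a i + c); rewrite -/(f (a i)).
congr (`|_ - _| <= _); apply: eq_bigr => wv _; congr (_ * `|_|).
by rewrite addrA (addrC (dot u' _)).
Qed.

(** The support function of [zonotope vs]. *)
Definition support_sum n (vs : seq 'rV[R]_n) (u : 'rV[R]_n) : R :=
  \sum_(v <- vs) `|dot u v|.

Lemma sum_coord_le_enorm n (u : 'rV[R]_n) : \sum_i `|u ord0 i| <= n%:R * enorm u.
Proof.
rewrite -[n in n%:R]card_ord -sumr_const mulr_suml.
by apply: ler_sum => i _; rewrite mul1r abs_coord_le_enorm.
Qed.

Lemma almost_euclidean_sections n b : 1 < b -> exists vs : seq 'rV[R]_n.+1,
  (forall v, v \in vs -> v ord0 ord0 != 0) /\
  forall u, b^-1 * enorm u <= support_sum vs u <= b * enorm u.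
Proof.
move=> b1; have b0 : 0 < b by exact: lt_trans b1.
have c0 := abs_mean1_gt0; set c := abs_mean 1 0 in c0.
(* A relative error d gives the lower factor 1 - d = 1 / b, and the upper factor 1 + d = 2 - 1 / b
   is at most b because (b - 1)^2 >= 0. In [eps], n + 1 compensates the comparison of the l1 and
   Euclidean norms. *)
pose d := 1 - b^-1.
have d0 : 0 < d by rewrite subr_gt0 invf_lt1.
pose eps := d * c / n.+1%:R.
have eps0 : 0 < eps by rewrite !mulr_gt0// invr_gt0.
have [fam [_ fam_pos famP]] := gaussian_family n.+1 eps0.
(* Zero weights are discarded because they would produce generators with zero first coordinate. *)
exists [seq (wv.1 / c) *: wv.2 | wv <- fam & wv.1 != 0]; split.
  move=> _ /mapP[wv + ->]; rewrite mem_filter => /andP[w0 /fam_pos[_ v0]].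
  by rewrite mxE !mulf_neq0// invr_eq0 gt_eqF.
move=> u; have -> : support_sum [seq (wv.1 / c) *: wv.2 | wv <- fam & wv.1 != 0] u =
    (\sum_(wv <- fam) wv.1 * `|dot u wv.2 + 0|) / c.
  rewrite /support_sum big_map big_filter mulr_suml [RHS](bigID (fun wv => wv.1 != 0))/=.
  rewrite [X in _ = _ + X]big1 ?addr0 => [|wv]; last first.
    by rewrite negbK => /eqP ->; rewrite !mul0r.
  rewrite big_seq_cond [RHS]big_seq_cond; apply: eq_bigr => wv /andP[/fam_pos[w0 _] _].
  have wc0 : 0 <= wv.1 / c by rewrite divr_ge0// ltW.
  by rewrite dotZr addr0 normrM (ger0_norm wc0) mulrAC.
have := famP u 0; rewrite abs_mean_scale ?enorm_ge0// -/c.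
set S := \sum_(wv <- fam) _; move=> h.
have {h} : `|S - enorm u * c| <= d * c * enorm u.
  apply: le_trans h _; apply: (@le_trans _ _ (eps * (n.+1%:R * enorm u))).
    by rewrite ler_wpM2l ?(ltW eps0)// sum_coord_le_enorm.
  by rewrite mulrA /eps divfK.
rewrite ler_distl => /andP[h1 h2].
rewrite ler_pdivlMr// ler_pdivrMr//; apply/andP; split.
  apply: le_trans h1; rewrite le_eqVlt; apply/orP; left; apply/eqP.
  by rewrite /d; ring.
apply: le_trans h2 _; rewrite (_ : _ + _ = (1 + d) * (c * enorm u)); last by ring.
rewrite -mulrA (mulrC (enorm u)) ler_wpM2r ?mulr_ge0 ?enorm_ge0 ?(ltW c0)//.
rewrite /d -(ler_pM2r b0) (_ : _ * b = 2 * b - 1); last by field; rewrite gt_eqF.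
have := sqr_ge0 (b - 1); nra.
Qed.

End GaussianFamilies.

(** * Inclusions between balls and zonotopes *)

Section ZonotopeBall.
Context (R : realType) (n : nat).
Implicit Types (vs : seq 'rV[R]_n) (u x y z : 'rV[R]_n) (b t : R).
Local Notation ball := (@euclidean_ball R n).

Lemma dilate_ballE t : 0 <= t -> dilate t ball = [set x | enorm x <= t].
Proof.
rewrite le_eqVlt => /predU1P[<-|t0].
  apply/seteqP; split => [_ [x _ <-]|x /= x0].
    by rewrite /= scale0r /enorm sqnE -(scale0r 0) dotZl mul0r sqrtr0.
  have -> : x = 0.
    apply: sqn_eq0; rewrite -enorm_sqr (_ : enorm x = 0) ?expr0n//.
    by apply/eqP; rewrite eq_le x0 enorm_ge0.
  exists 0; last by rewrite scaler0.
  by rewrite /euclidean_ball /mkset -[X in X <= _]/(sqn 0) sqnE -(scale0r 0) dotZl mul0r.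
have enormZ x : enorm (t *: x) = t * enorm x.
  by rewrite /enorm sqnZ sqrtrM ?sqr_ge0// sqrtr_sqr gtr0_norm.
have ballP x : ball x <-> enorm x <= 1.
  rewrite /euclidean_ball /mkset -/(sqn x) -enorm_sqr.
  by rewrite -[X in _ <= X](expr1n _ 2) ler_pXn2r// ?nnegrE ?enorm_ge0.
apply/seteqP; split => [_ [x /ballP x1 <-]|x /= xt].
  by rewrite /= enormZ ler_piMr// ltW.
exists (t^-1 *: x); last by rewrite scalerA mulfV ?scale1r// gt_eqF.
apply/ballP; have := enormZ (t^-1 *: x).
by rewrite scalerA mulfV ?gt_eqF// scale1r => e; move: xt; rewrite e ger_pMr.
Qed.

Lemma dot_zonotope_le vs u z : zonotope vs z -> dot u z <= support_sum vs u.
Proof.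
rewrite /support_sum; elim: vs z => [|v vs IH] z /=.
  by move=> ->; rewrite big_nil -(scale0r 0) dotZr mul0r.
move=> [_ [s + <-] [y /IH uy <-]]; rewrite /= in_itv/= -ler_norml => s1.
rewrite big_cons dotDr dotZr lerD//; apply: le_trans (ler_norm _) _.
by rewrite normrM ler_piMl.
Qed.

(** Each segment is maximized separately, at the endpoint selected by the sign of <u, v>. *)
Lemma zonotope_support vs u : exists2 z, zonotope vs z & dot u z = support_sum vs u.
Proof.
rewrite /support_sum; elim: vs => [|v vs [z Zz uz]] /=.
  by exists 0 => //; rewrite big_nil -(scale0r 0) dotZr mul0r.
exists (Num.sg (dot u v) *: v + z).
  exists (Num.sg (dot u v) *: v); last by exists z.
  by exists (Num.sg (dot u v)) => //=; rewrite in_itv/= -ler_norml normr_sg; case: (_ != 0).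
by rewrite big_cons dotDr dotZr uz -normrEsg.
Qed.

(** Test a point x in its own direction: |x|^2 = <x, x> <= b |x|. *)
Lemma zonotope_sub_ball vs b : 0 <= b ->
  (forall u, support_sum vs u <= b * enorm u) -> zonotope vs `<=` dilate b ball.
Proof.
move=> b0 H x Zx; rewrite dilate_ballE//=.
have := le_trans (dot_zonotope_le x Zx) (H x); rewrite -sqnE -enorm_sqr expr2.
have [->|x0] := eqVneq (enorm x) 0; first by [].
by rewrite ler_pM2r// lt0r x0 enorm_ge0.
Qed.

(* A point [x] outside the zonotope is separated from it by [x - y], where [y]
   is the nearest point of the zonotope. *)
Lemma ball_sub_zonotope vs b : 0 <= b ->
  (forall u, b * enorm u <= support_sum vs u) -> dilate b ball `<=` zonotope vs.
Proof.
move=> b0 H x; rewrite dilate_ballE//= => xb.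
have /convex_bodyP[Z0 cZ vZ] := convex_body_zonotope vs.
have [y Zy ymin] := nearest_point x Z0 cZ.
apply: contrapT => nZx; pose u := x - y.
have u0 : 0 < sqn u.
  rewrite lt0r sqn_ge0 andbT; apply/eqP => /sqn_eq0/subr0_eq xy.
  by apply: nZx; rewrite xy.
have var z : zonotope vs z -> dot u (z - y) <= 0.
  move=> Zz; rewrite leNgt; apply/negP => uz.
  pose q := sqn (z - y).
  have q0 : 0 <= q by exact: sqn_ge0.
  (* Moving from y towards z by the fraction c changes the squared distance by c (c q - 2 <u, z -
     y>), which is negative for this c. The cap 1 stays in the zonotope, and q + 1 cannot vanish. *)
  pose c := Num.min 1 (dot u (z - y) / (q + 1)).
  have q1 : 0 < q + 1 by rewrite ltr_wpDl.
  have c0 : 0 < c by rewrite lt_min ltr01 divr_gt0.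
  have c1 : c <= 1 by rewrite ge_min lexx.
  have cq : c * (q + 1) <= dot u (z - y).
    by rewrite -ler_pdivlMr// ge_min lexx orbT.
  have := ymin _ (vZ z y c Zz Zy (introT andP (conj (ltW c0) c1))).
  rewrite (_ : x - (c *: z + (1 - c) *: y) = u + (- c) *: (z - y)); last first.
    by apply/rowP => i; rewrite !mxE; ring.
  rewrite -/u sqnD sqnZ dotZr -/q sqrrN => h.
  have : 0 <= c * (c * q - 2 * dot u (z - y)) by lra.
  by rewrite pmulr_rge0//; nra.
(* With h the support function, h(u) <= <u, y> = <u, x> - |u|^2 < <u, x> <= b |u| <= h(u), a
   contradiction. *)
have [z Zz uz] := zonotope_support vs u.
have := var z Zz; rewrite dotDr uz dotNr => h1.
have h2 : dot u y = dot u x - sqn u.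
  by rewrite sqnE {3}/u dotDr dotNr; ring.
have h3 := cauchy_schwarz u x; have h4 := H u.
have h5 : enorm u * enorm x <= enorm u * b by rewrite ler_wpM2l ?enorm_ge0.
by lra.
Qed.

End ZonotopeBall.

(** * Steiner formula *)

Section Steiner.
Context (R : realType) (n : nat).
Local Notation ball := (@euclidean_ball R n.+1).
Implicit Types (K Z : set 'rV[R]_n.+1) (t a : R).

Lemma compact_minkowski_dilate K Z t : convex_body K -> convex_body Z ->
  compact (minkowski_sum K (dilate t Z)).
Proof. by move=> bK bZ; have [] := convex_body_minkowski_sum bK (convex_body_dilate t bZ). Qed.

(** As K contains 0, K lies in a K, so K + a t Z lies in a (K + t Z). This yields both the degree
    bound and the relative error of the approximation. *)
Lemma vol_minkowski_dilate_le K Z a t : convex_body K -> convex_body Z -> K 0 ->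
  1 <= a -> 0 <= t ->
  (vol (minkowski_sum K (dilate (a * t) Z)) <=
   (a ^+ n.+1)%:E * vol (minkowski_sum K (dilate t Z)))%E.
Proof.
move=> bK bZ K0 a1 t0; have a0 : 0 < a by exact: lt_le_trans a1.
rewrite -vol_dilate//; last exact: compact_minkowski_dilate.
apply: le_vol; first exact: compact_minkowski_dilate.
  by have [] := convex_body_dilate a (convex_body_minkowski_sum bK (convex_body_dilate t bZ)).
rewrite dilateD dilateM; apply: minkowski_sumS => // x Kx.
exists (a^-1 *: x); last by rewrite scalerA mulfV ?scale1r// gt_eqF.
have /convex_bodyP[_ _ vK] := bK.
have := vK x 0 a^-1 Kx K0; rewrite scaler0 addr0; apply.
by rewrite invr_ge0 (ltW a0) invf_le1.
Qed.

Lemma vol_zonotope_poly_size K (vs : seq 'rV[R]_n.+1) : convex_body K -> K 0 ->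
  (forall v, v \in vs -> v ord0 ord0 != 0) ->
  exists2 p : {poly R}, (size p <= n.+2)%N & forall t, 0 <= t ->
    vol (minkowski_sum K (dilate t (zonotope vs))) = (p.[t])%:E.
Proof.
move=> bK K0 vs0; have [p pE] := vol_zonotope_poly bK vs0; exists p => //.
apply: (@size_poly_growth _ _ _ (p.[1])) => t t1; have t0 : 0 <= t by exact: le_trans t1.
rewrite ger0_norm -lee_fin -?pE// ?measure_ge0// mulrC EFinM -pE//.
rewrite -{1}(mulr1 t); apply: vol_minkowski_dilate_le => //.
exact: convex_body_zonotope.
Qed.

Lemma vol_parallel_poly0 K : convex_body K -> K 0 ->
  exists2 p : {poly R}, (size p <= n.+2)%N & forall t, 0 <= t ->
    vol (minkowski_sum K (dilate t ball)) = (p.[t])%:E.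
Proof.
move=> bK K0; have bB := convex_body_ball R n.+1.
pose f t := fine (vol (minkowski_sum K (dilate t ball))).
have fE t : vol (minkowski_sum K (dilate t ball)) = (f t)%:E.
  by rewrite fineK// fin_num_vol//; exact: compact_minkowski_dilate.
suff [p sp pE] : exists2 p : {poly R}, (size p <= n.+2)%N & forall t, 0 <= t -> f t = p.[t].
  by exists p => // t t0; rewrite fE pE.
apply: poly_relative_limit => eta eta0.
(* Replacing the zonotope by the ball or conversely costs a dilation by a, hence a volume factor of
   at most a^(n + 1) = 1 + eta. *)
pose a := (1 + eta) `^ (n.+1%:R^-1).
have aE : a ^+ n.+1 = 1 + eta.
  rewrite -powR_mulrn ?powR_ge0// -powRrM mulVf ?powRr1//.
  by rewrite ltW// ltr_wpDl.
have a1 : 1 < a.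
  rewrite ltNge; apply/negP => a1; have : a ^+ n.+1 <= 1 by rewrite exprn_ile1// powR_ge0.
  by rewrite aE leNgt ltrDl eta0.
have a0 : 0 < a by exact: lt_trans a1.
have [vs [vs0 vsP]] := almost_euclidean_sections n a1.
have [p sp pE] := vol_zonotope_poly_size bK K0 vs0.
have bZ := convex_body_zonotope vs.
exists p => // t t0.
have p_le : p.[t] <= f t * (1 + eta).
  rewrite -lee_fin -pE// mulrC EFinM -fE -aE.
  apply: le_trans _ (vol_minkowski_dilate_le bK bB K0 (ltW a1) t0).
  apply: le_vol; [exact: compact_minkowski_dilate|exact: compact_minkowski_dilate|].
  apply: minkowski_sumS => //; rewrite mulrC -dilateM; apply: dilateS.
  by apply: zonotope_sub_ball; [exact: ltW|move=> u; have /andP[] := vsP u].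
have f_le : f t <= p.[t] * (1 + eta).
  rewrite -lee_fin -fE mulrC EFinM -pE// -aE.
  apply: le_trans _ (vol_minkowski_dilate_le bK bZ K0 (ltW a1) t0).
  apply: le_vol; [exact: compact_minkowski_dilate|exact: compact_minkowski_dilate|].
  apply: minkowski_sumS => //.
  have {1}-> : t = a * t * a^-1 by field; rewrite gt_eqF.
  rewrite -dilateM; apply: dilateS.
  apply: ball_sub_zonotope; first by rewrite invr_ge0 ltW.
  by move=> u; have /andP[] := vsP u.
have f0 : 0 <= f t by rewrite fine_ge0// measure_ge0.
have p0 : 0 <= p.[t] by rewrite -lee_fin -pE// measure_ge0.
(* The lower bound on p comes from p >= f / (1 + eta) >= (1 - eta) f. *)
rewrite ler_distl; apply/andP; split; nra.
Qed.

(** A translation moves a point of K to the origin without changing volumes. *)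
Lemma vol_parallel_poly K : convex_body K ->
  exists2 p : {poly R}, (size p <= n.+2)%N & forall t, 0 <= t ->
    vol (minkowski_sum K (dilate t ball)) = (p.[t])%:E.
Proof.
move=> bK; have /convex_bodyP[[x0 Kx0] cK vK] := bK.
pose K' := minkowski_sum K [set - x0].
have bK' : convex_body K' by apply: convex_body_minkowski_sum => //; exact: convex_body_set1.
have K'0 : K' 0 by exists x0 => //; exists (- x0) => //; rewrite subrr.
have [p sp pE] := vol_parallel_poly0 bK' K'0; exists p => // t t0.
rewrite -pE// /K' -minkowski_sumA (minkowski_sumC [set - x0]) minkowski_sumA.
have -> : minkowski_sum (minkowski_sum K (dilate t ball)) [set - x0] =
    [set 1 *: x + (- x0) | x in minkowski_sum K (dilate t ball)].
  apply/seteqP; split => [_ [x Kx [_ -> <-]]|_ [x Kx <-]].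
    by exists x; rewrite ?scale1r.
  by exists x => //; exists (- x0) => //; rewrite scale1r.
rewrite vol_affine ?expr1n ?mul1e//; apply: compact_minkowski_dilate => //.
exact: convex_body_ball.
Qed.

End Steiner.

(** * Integral representation of the Wills functional *)

Section ClosedLayerCake.
Context d (T : measurableType d) (R : realType).
Variable mu : {sigma_finite_measure set T -> \bar R}.
Local Notation mR := (measurableTypeR R).
Let leb : {sigma_finite_measure set mR -> \bar R} := @lebesgue_measure R.
Local Open Scope ereal_scope.

(** Closed superlevel sets of the Gaussian of the distance are exactly parallel bodies, to which the
    Steiner formula applies. The open range of heights excludes 0, where the level radius would be
    infinite. *)
Lemma closed_layer_cake (F : T -> R) : measurable_fun setT F ->
  (forall x, 0 <= F x <= 1)%R ->
  \int[mu]_x (F x)%:E = \int[leb]_(t in `]0%R, 1%R[) mu [set x | (t <= F x)%R].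
Proof.
move=> mF F01; set D := [set z : mR * T | (z.1 \in `]0%R, 1%R[) /\ (z.1 <= F z.2)%R].
have mD : measurable D.
  have mle : measurable [set z : mR * T | z.1%:E <= (F z.2)%:E].
    rewrite -[X in measurable X]setTI.
    apply: measurable_lee => //; apply/measurable_EFinP; first exact: measurable_fst.
    by apply: measurableT_comp => //; exact: measurable_snd.
  rewrite (_ : D = fst @^-1` `]0%R, 1%R[ `&` [set z : mR * T | z.1%:E <= (F z.2)%:E]).
    apply: measurableI => //.
    by rewrite -[X in measurable X]setTI; exact: measurable_fst.
  by apply/seteqP; split => z; rewrite /D/= lee_fin.
transitivity (\int[mu]_x \int[leb]_t (\1_D (t, x))%:E).
  apply: eq_integral => x _.
  have -> : (fun t : mR => (\1_D (t, x))%:E) =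
            (fun t : mR => (\1_(ysection D x) t)%:E :> \bar R).
    by apply/funext => t; rewrite !indicE /ysection mem_setE.
  rewrite integral_indic//=; last exact: measurable_ysection.
  rewrite setIT.
  have /andP[F0 F1] := F01 x.
  (* The fibre lies between ]0, F x[ and ]0, F x], which have the same length. *)
  apply/eqP; rewrite eq_le; apply/andP; split.
    have -> : (F x)%:E = leb `]0%R, F x[%classic.
      rewrite [RHS]lebesgue_measure_itv/= lte_fin.
    case: ltP => [_|]; first by rewrite oppr0 adde0.
      by move=> F0'; congr EFin; apply/eqP; rewrite eq_le F0 F0'.
    apply: le_measure; rewrite ?inE//; first exact: measurable_ysection.
    move=> t /=; rewrite in_itv/= /ysection/= inE /D/= in_itv/= => /andP[t0 tF].
    by rewrite t0 (lt_le_trans tF F1) ltW.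
  have -> : (F x)%:E = leb `]0%R, F x]%classic.
    rewrite [RHS]lebesgue_measure_itv/= lte_fin.
    case: ltP => [_|]; first by rewrite oppr0 adde0.
    by move=> F0'; congr EFin; apply/eqP; rewrite eq_le F0 F0'.
  apply: le_measure; rewrite ?inE//; first exact: measurable_ysection.
  by move=> t /=; rewrite in_itv/= /ysection/= inE /D/= in_itv/= => -[/andP[-> _] ->].
rewrite -(fubini_tonelli (fun z : mR * T => (\1_D z)%:E))//=; last first.
  by apply/measurable_EFinP.
rewrite [RHS]integral_mkcond/=; apply: eq_integral => t _.
have -> : (fun x : T => (\1_D (t, x))%:E) =
          (fun x : T => (\1_(xsection D t) x)%:E :> \bar R).
  by apply/funext => x; rewrite !indicE /xsection mem_setE.
rewrite integral_indic//=; last exact: measurable_xsection.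
rewrite setIT patchE; case: ifPn => [|]; rewrite ?inE/= ?notin_setE/= => t01.
  congr (mu _); apply/seteqP; split => x; rewrite /xsection/= inE/=; first by case.
  by move=> ?; split.
rewrite -[RHS](measure0 mu); congr (mu _).
by apply/seteqP; split => x; rewrite /xsection/= inE//= => -[].
Qed.

End ClosedLayerCake.

(** * The Gaussian of the distance and its moments *)

Section DistanceFunction.
Context (R : realType).
Local Notation mR := (measurableTypeR R).
Local Notation mu := (lebesgue_tuple R).
Local Notation ball := (@euclidean_ball R _).
Implicit Types (n : nat) (c t : R).

Definition dist_sqr n (K : set 'rV[R]_n) (x : 'rV[R]_n) : R :=
  inf [set sqn (x - y) | y in K].

Lemma dist_sqrP n (K : set 'rV[R]_n) x : convex_body K ->
  exists2 y, K y & dist_sqr K x = sqn (x - y) /\ forall z, K z -> dist_sqr K x <= sqn (x - z).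
Proof.
move=> [K0 cK _]; have [y Ky ymin] := nearest_point x K0 cK.
have hi : has_inf [set sqn (x - y) | y in K].
  by split; [exists (sqn (x - y)), y|exists 0 => _ [z _ <-]; exact: sqn_ge0].
have dz z : K z -> dist_sqr K x <= sqn (x - z).
  by move=> Kz; apply: ge_inf; [exact: hi.2|exists z].
exists y => //; split => //; apply/eqP; rewrite eq_le dz//=.
by apply: lb_le_inf; [exact: hi.1|move=> _ [z Kz <-]; exact: ymin].
Qed.

Definition gauss_dist n (K : set 'rV[R]_n) (t : n.-tuple mR) : R :=
  expR (- (pi * dist_sqr K (row_of_tuple t))).

(* The radius [r >= 0] with [exp (- pi r ^ 2) = c]. *)
Definition level_radius c : R := Num.sqrt (- ln c / pi).

Lemma gauss_dist01 n (K : set 'rV[R]_n) (t : n.-tuple mR) :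
  convex_body K -> 0 <= gauss_dist K t <= 1.
Proof.
move=> bK; rewrite expR_ge0/= -[leRHS]expR0 ler_expR oppr_le0 mulr_ge0 ?pi_ge0//.
by have [y _ [-> _]] := dist_sqrP (row_of_tuple t) bK; exact: sqn_ge0.
Qed.

(** The distance to K is attained, so being at distance at most r means lying in K + r B, boundary
    included. *)
Lemma gauss_dist_level n (K : set 'rV[R]_n) c : convex_body K -> 0 < c <= 1 ->
  [set t : n.-tuple mR | c <= gauss_dist K t] =
  @row_of_tuple R n @^-1` minkowski_sum K (dilate (level_radius c) ball).
Proof.
move=> bK /andP[c0 c1].
have lc : 0 <= - ln c / pi by rewrite divr_ge0 ?pi_ge0// oppr_ge0 ln_le0.
have levelP (x : 'rV[R]_n) :
    (c <= expR (- (pi * dist_sqr K x))) = (dist_sqr K x <= level_radius c ^+ 2).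
  rewrite sqr_sqrtr// ler_pdivlMr ?pi_gt0// -[c in LHS]lnK ?posrE// ler_expR.
  by rewrite lerNr (mulrC pi).
apply/seteqP; split => t; rewrite /gauss_dist /= levelP; set x := row_of_tuple t.
  have [y Ky [-> _]] := dist_sqrP x bK => xy.
  exists y => //; exists (x - y); last by rewrite addrC subrK.
  rewrite dilate_ballE ?sqrtr_ge0//=.
  by rewrite -(ler_pXn2r (n := 2))// ?nnegrE ?sqrtr_ge0// enorm_sqr.
move=> [y Ky [u + e]]; rewrite dilate_ballE ?sqrtr_ge0//= => ur.
have [_ _ [_ /(_ y Ky)/le_trans]] := dist_sqrP x bK; apply.
rewrite -e addrAC subrr add0r -enorm_sqr.
by rewrite ler_pXn2r// ?nnegrE ?sqrtr_ge0.
Qed.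

Lemma convex_body_parallel n (K : set 'rV[R]_n) t : convex_body K ->
  convex_body (minkowski_sum K (dilate t ball)).
Proof.
move=> bK; apply: convex_body_minkowski_sum => //.
by apply: convex_body_dilate; exact: convex_body_ball.
Qed.

Lemma measurable_gauss_dist n (K : set 'rV[R]_n) : convex_body K ->
  measurable_fun setT (gauss_dist K).
Proof.
move=> bK; apply: (measurability _ (RGenCInfty.measurableE R)) => // _ [_ [c ->] <-].
rewrite setTI (_ : _ @^-1` _ = [set t : n.-tuple mR | c <= gauss_dist K t]); last first.
  by apply/seteqP; split => t; rewrite /= in_itv/= andbT.
have [c0|c0] := leP c 0.
  rewrite (_ : mkset _ = setT)//; apply/seteqP; split => // t _ /=.
  by rewrite (le_trans c0)// expR_ge0.
have [c1|c1] := leP c 1.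
  rewrite gauss_dist_level ?c0//; apply: compact_measurable_row.
  by have [] := convex_body_parallel (level_radius c) bK.
rewrite (_ : mkset _ = set0)//; apply/seteqP; split => // t /= ct.
by have /andP[_] := gauss_dist01 t bK; rewrite leNgt (lt_le_trans c1 ct).
Qed.

Lemma integral_gauss_dist n (K : set 'rV[R]_n) : convex_body K ->
  (\int[mu n]_t (gauss_dist K t)%:E =
   \int[@lebesgue_measure R]_(c in `]0%R, 1%R[)
     vol (minkowski_sum K (dilate (level_radius c) ball)))%E.
Proof.
move=> bK; rewrite (closed_layer_cake (mu n) (measurable_gauss_dist bK)); last first.
  by move=> t; exact: gauss_dist01.
apply: eq_integral => c; rewrite inE/= in_itv/= => /andP[c0 c1].
by rewrite gauss_dist_level ?c0 ?ltW.
Qed.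

Lemma gauss_dist_set0 n (t : n.-tuple mR) :
  gauss_dist [set 0] t = \prod_(i < n) gaussian (tnth t i).
Proof.
have [y -> [+ _]] := dist_sqrP (row_of_tuple t) (convex_body_set1 (0 : 'rV[R]_n)).
rewrite /gauss_dist subr0 => ->; rewrite /gaussian -expR_sum; congr expR.
by rewrite /sqn mulr_sumr -sumrN; apply: eq_bigr => i _; rewrite mxE.
Qed.

Lemma integral_gaussian_tuple n :
  (\int[mu n]_t (\prod_(i < n) gaussian (tnth t i))%:E = 1)%E.
Proof.
have mg k : measurable_fun setT
    (fun t : k.-tuple mR => (\prod_(i < k) gaussian (tnth t i))%:E : \bar R).
  apply/measurable_EFinP.
  have := measurable_gauss_dist (convex_body_set1 (0 : 'rV[R]_k)).
  by congr measurable_fun; apply/funext => t; rewrite gauss_dist_set0.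
have g0 k (t : k.-tuple mR) : (0 <= (\prod_(i < k) gaussian (tnth t i))%:E :> \bar R)%E.
  by rewrite lee_fin; apply: prodr_ge0 => i _; rewrite ltW// gaussian_gt0.
elim: n => [|n IH].
  rewrite /lebesgue_tuple integral_dirac//; last exact: (mg 0%N).
  by rewrite diracE in_setT mul1e big_ord0.
rewrite integral_lebesgue_tupleS//.
rewrite -[RHS](integral_gaussian R); apply: eq_integral => x _.
under eq_integral => t _.
  rewrite big_ord_recl /consp tnth0 (eq_bigr (fun i => gaussian (tnth t i))); last first.
    by move=> i _; rewrite tnthS.
  rewrite EFinM /=; over.
rewrite /= ge0_integralZl_EFin;
  [|by []|by move=> t _; exact: g0|exact: (mg n)|by rewrite ltW// gaussian_gt0].
by rewrite IH mule1.
Qed.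

Lemma measurable_level_radius j D :
  measurable_fun D (fun c : mR => (level_radius c ^+ j)%:E : \bar R).
Proof.
apply: measurable_funTS; apply/measurable_EFinP.
apply: measurableT_comp (exprn_measurable _) _.
apply: measurableT_comp; first by apply: continuous_measurable_fun; exact: sqrt_continuous.
by apply: measurable_funM => //; apply: measurableT_comp => //; exact: measurable_ln.
Qed.

(* The level sets of the Gaussian [gauss_dist [set 0]] are balls. *)
Lemma kappa_moment j : ((kappa R j)%:E *
  \int[@lebesgue_measure R]_(c in `]0%R, 1%R[) (level_radius c ^+ j)%:E = 1)%E.
Proof.
have bB := convex_body_ball R j; have cB : compact (@euclidean_ball R j) by case: bB.
have k0 : 0 <= kappa R j by rewrite fine_ge0// measure_ge0.
rewrite -(integral_gaussian_tuple j).
under [RHS]eq_integral => t _ do rewrite -gauss_dist_set0.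
rewrite (integral_gauss_dist (convex_body_set1 (0 : 'rV[R]_j))).
rewrite -ge0_integralZl_EFin//; last 2 first.
- by move=> c _; rewrite lee_fin exprn_ge0// sqrtr_ge0.
- exact: measurable_level_radius.
apply: eq_integral => c; rewrite inE/= in_itv/= => /andP[c0 c1].
rewrite minkowski_sumC minkowski_sum0 vol_dilate//.
  by rewrite muleC /kappa fineK// fin_num_vol.
by rewrite sqrtr_gt0 divr_gt0 ?pi_gt0// oppr_gt0 ln_lt0// c0.
Qed.

(** If kappa vanished, the moment identity would read 0 = 1. *)
Lemma kappa_gt0 j : 0 < kappa R j.
Proof.
have k0 : 0 <= kappa R j by rewrite fine_ge0// measure_ge0.
rewrite lt0r k0 andbT; apply/eqP => k_eq0; have := kappa_moment j.
by rewrite k_eq0 mul0e => /eqP; rewrite eq_sym onee_eq0.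
Qed.

Lemma steiner_formula_exists n (K : set 'rV[R]_n) : convex_body K ->
  exists V, steiner_formula K V.
Proof.
move=> bK.
have [p sp pE] : exists2 p : {poly R}, (size p <= n.+1)%N & forall t, 0 <= t ->
    vol (minkowski_sum K (dilate t ball)) = (p.[t])%:E.
  (* In dimension 0 there is no axis to shear along; the parallel body is the single point, of
     volume 1. *)
  case: n K bK => [|n] K bK; last exact: vol_parallel_poly.
  exists 1; first by rewrite size_poly1.
  move=> t t0; have [[x Px] _ _] := convex_body_parallel t bK.
  rewrite hornerC /vol/= diracE mem_set//=.
  by have -> : \row_i tnth [tuple] i = x by apply/rowP => -[].
(* V_i multiplies the power n - i, so the coefficients are read in reverse order and divided by the
   positive kappa. *)
exists [ffun i : 'I_n.+1 => p`_(n - i) / kappa R (n - i)] => t t0.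
rewrite pE//; congr EFin; rewrite (horner_coef_wide t sp).
rewrite (reindex_inj rev_ord_inj)/=; apply: eq_bigr => i _.
by rewrite ffunE subSS mulrCA mulfV ?mulr1// gt_eqF// kappa_gt0.
Qed.

Lemma wills_integral n (K : set 'rV[R]_n) : convex_body K ->
  (wills K)%:E = (\int[mu n]_t (gauss_dist K t)%:E)%E.
Proof.
move=> bK.
have SV : steiner_formula K (intrinsic_volume K) by exact: xgetPex (steiner_formula_exists bK).
rewrite integral_gauss_dist// /wills; set V := intrinsic_volume K in SV *.
transitivity (\int[@lebesgue_measure R]_(c in `]0%R, 1%R[) \sum_(i < n.+1)
    ((kappa R (n - i) * V i)%:E * (level_radius c ^+ (n - i))%:E))%E; last first.
  apply: eq_integral => c _; rewrite SV ?sqrtr_ge0// -sumEFin.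
  by apply: eq_bigr => i _; rewrite -EFinM.
(* An infinite moment times the positive kappa would be infinite rather than 1. *)
have intr j : (@lebesgue_measure R).-integrable `]0%R, 1%R[
    (fun c => (level_radius c ^+ j)%:E).
  apply/integrableP; split; first exact: measurable_level_radius.
  under eq_integral => c _ do rewrite /= ger0_norm ?exprn_ge0 ?sqrtr_ge0//.
  rewrite ltey; apply/eqP => e; have := kappa_moment j.
  by rewrite e gt0_muley// lte_fin kappa_gt0.
rewrite integral_sum//; last by move=> i; apply: integrableZl => //; exact: intr.
rewrite -sumEFin; apply: eq_bigr => i _.
rewrite integralZl//.
by rewrite (mulrC (kappa R _)) EFinM -muleA kappa_moment mule1.
Qed.

End DistanceFunction.

(** * Log-concavity and the inequality for the Wills functional *)

(** The combination of the nearest points lies in the combined body and bounds its distance;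
    convexity of the squared norm does the rest. *)
Lemma dist_sqr_convex (R : realType) (n : nat) (K L : set 'rV[R]_n) (p : R) x y :
  convex_body K -> convex_body L -> 0 <= p <= 1 ->
  dist_sqr (minkowski_sum (dilate (1 - p) K) (dilate p L)) ((1 - p) *: x + p *: y) <=
  (1 - p) * dist_sqr K x + p * dist_sqr L y.
Proof.
move=> bK bL p01.
have [a Ka [-> _]] := dist_sqrP x bK; have [b Lb [-> _]] := dist_sqrP y bL.
have bM := convex_body_minkowski_sum (convex_body_dilate (1 - p) bK) (convex_body_dilate p bL).
have Mab : minkowski_sum (dilate (1 - p) K) (dilate p L) ((1 - p) *: a + p *: b).
  by exists ((1 - p) *: a); [exists a|exists (p *: b) => //; exists b].
have [_ _ [_ /(_ _ Mab)/le_trans]] := dist_sqrP ((1 - p) *: x + p *: y) bM; apply.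
rewrite (_ : _ - _ = (1 - p) *: (x - a) + p *: (y - b)); first exact: sqn_convex.
by apply/rowP => i; rewrite !mxE; ring.
Qed.

Lemma gauss_dist_log_concave (R : realType) (n : nat) (K L : set 'rV[R]_n) (p : R)
    (s t : n.-tuple (measurableTypeR R)) :
  convex_body K -> convex_body L -> 0 < p < 1 ->
  gauss_dist K s `^ (1 - p) * gauss_dist L t `^ p <=
  gauss_dist (minkowski_sum (dilate (1 - p) K) (dilate p L)) (tuple_comb p s t).
Proof.
move=> bK bL /andP[p0 p1].
rewrite /gauss_dist -!expRM -expRD ler_expR.
have -> : row_of_tuple (tuple_comb p s t) =
    (1 - p) *: row_of_tuple s + p *: row_of_tuple t.
  by apply/rowP => i; rewrite !mxE tnth_mktuple.
have p01 : 0 <= p <= 1 by rewrite !ltW.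
have := dist_sqr_convex (row_of_tuple s) (row_of_tuple t) bK bL p01.
rewrite -(ler_pM2l (pi_gt0 R)) => h; lra.
Qed.

Theorem theorem1p4 (R : realType) (n : nat) (K L : set 'rV[R]_n) (lambda : R) :
  convex_body K -> convex_body L -> 0 < lambda < 1 ->
  wills (minkowski_sum (dilate (1 - lambda) K) (dilate lambda L)) >=
  wills K `^ (1 - lambda) * wills L `^ lambda.
Proof.
move=> bK bL l01.
have bM : convex_body (minkowski_sum (dilate (1 - lambda) K) (dilate lambda L)).
  by apply: convex_body_minkowski_sum; exact: convex_body_dilate.
rewrite -lee_fin EFinM -!poweR_EFin !wills_integral//.
have mG (A : set 'rV[R]_n) : convex_body A ->
    measurable_fun setT (fun t => (gauss_dist A t)%:E).
  by move=> bA; apply/measurable_EFinP; exact: measurable_gauss_dist.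
apply: prekopa_leindler => //; try exact: mG; try by move=> t; rewrite lee_fin expR_ge0.
move=> s t; rewrite !poweR_EFin -EFinM lee_fin.
exact: gauss_dist_log_concave.
Qed.
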